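(* There is an absolute constant $C>0$ such that the following holds. Let $s \ge 1$ be an integer, $0 \le \gamma \le C/s$, and let $A: \mathbb{R}^{s^2} \rightarrow \mathbb{R}^m$ be a non-zero linear map. Suppose that for all integers $1 \le t,t' \le s$, \[ \Pr_{x\sim \mathrm{Unif}_t,\, y \sim\mathrm{Unif}_{t'} }\left( |\langle Ax, Ay \rangle - \langle x, y \rangle| \le \gamma \|x\|_2 \|y\|_2 \right) \ge 0.99,\] where $x$ and $y$ are drawn independently, and that \[ \Pr_{ y \sim\mathrm{Unif}_{1} }\left( \big|\|Ay\|_2^2- \|y\|_2^2\big| \le \gamma \|y\|_2^2 \right) \ge 0.99.\] Then $m \ge s^2/1000$.
   Context: For integers $1 \le t \le s^2$ and real $r>0$, the distribution $\mathrm{Unif}_{t,r}$ on $\mathbb{R}^{s^2}$ is defined as follows: to sample $x \sim \mathrm{Unif}_{t,r}$, first choose a subset of $t$ coordinates of $[s^2]$ uniformly at random to be the support; then the coordinates of $x$ in the support are i.i.d. mean-zero Gaussians with variance $r$, and all other coordinates are $0$. $\mathrm{Unif}_t$ denotes $\mathrm{Unif}_{t,1}$. *)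

(* Defs.v *)
From HB Require Import structures.
From mathcomp Require Import all_boot all_order all_algebra.
From mathcomp Require Import all_classical all_reals all_analysis.

Set Implicit Arguments.
Unset Strict Implicit.
Unset Printing Implicit Defensive.

Import Order.TTheory GRing.Theory Num.Theory.
Import numFieldNormedType.Exports.

Local Open Scope classical_set_scope.
Local Open Scope ring_scope.

Section product_law.
Context d (T : measurableType d) (R : realType).

Definition tuple_cons n (p : T * n.-tuple T) : n.+1.-tuple T :=
  [tuple of p.1 :: p.2].

Lemma measurable_tuple_cons n :
  measurable_fun [set: T * n.-tuple T] (@tuple_cons n).
Proof. exact: measurable_cons. Qed.

HB.instance Definition _ n :=
  isMeasurableFun.Build _ _ _ _ (@tuple_cons n) (@measurable_tuple_cons n).

(* Joint law of independent coordinates, the i-th one having law P i;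
   see product_law_box. *)
Fixpoint product_law n :
    ('I_n -> probability T R) -> probability (n.-tuple T) R :=
  match n with
  | 0 => fun=> \d_[tuple]
  | n'.+1 => fun P =>
      distribution (P ord0 \x product_law (fun i => P (lift ord0 i)))%E
        (@tuple_cons n')
  end.

Lemma measurable_box n (B : 'I_n -> set T) : (forall i, measurable (B i)) ->
  measurable [set x : n.-tuple T | forall i, B i (tnth x i)].
Proof.
move=> mB; rewrite (_ : [set _ | _] =
    \big[setI/setT]_(i < n) [set x | B i (tnth x i)]).
  apply: bigsetI_measurable => i _.
  by rewrite -[X in measurable X]setTI; exact: measurable_tnth.
apply/seteqP; split=> x /=; rewrite -bigcap_seq /=.
  by move=> Bx i _; exact: Bx.
by move=> Bx i; exact: Bx (mem_index_enum i).
Qed.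

Lemma product_law_box n (P : 'I_n -> probability T R) (B : 'I_n -> set T) :
  (forall i, measurable (B i)) ->
  product_law P [set x | forall i, B i (tnth x i)] =
  (\prod_(i < n) P i (B i))%E.
Proof.
elim: n P B => [|n IH] P B mB /=.
  by rewrite big_ord0 diracE mem_set//= => -[].
rewrite big_ord_recl.
rewrite -(IH _ (fun i => B (lift ord0 i))); last by move=> i; exact: mB.
rewrite -product_measure1E//; last first.
  by apply: (@measurable_box n (fun i => B (lift ord0 i))) => i; exact: mB.
rewrite /distribution /pushforward /=; congr (product_measure1 _ _ _).
apply/seteqP; split=> [[a x] /= Bx|[a x] /= [Ba Bx] i].
  split; first exact: Bx ord0.
  by move=> i; have := Bx (lift ord0 i); rewrite /tuple_cons tnthS.
have [j ->|->//] := unliftP ord0 i.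
by rewrite /tuple_cons tnthS.
Qed.

End product_law.

Section Unif.
Context (R : realType).
Variables (n t : nat) (r : R).

(* The second parameter of normal_prob is the standard deviation. *)
Definition coord_law (S : {set 'I_n}) (i : 'I_n) :
    probability (measurableTypeR R) R :=
  if i \in S
  then (normal_prob 0 (Num.sqrt r) : probability (measurableTypeR R) R)
  else (\d_(0 : measurableTypeR R) : probability (measurableTypeR R) R).

(* The law Unif_{t,r} on R^n, meant for 1 <= t <= n and r > 0: the average,
   over the 'C(n, t) subsets S of size t, of the law of a vector with
   independent coordinates that are N(0, r) on S and 0 off S. *)
Definition Unif (A : set (n.-tuple (measurableTypeR R))) : \bar R :=
  ('C(n, t)%:R^-1%:E *
   \sum_(S : {set 'I_n} | #|S| == t) product_law (coord_law S) A)%E.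

Let Unif0 : Unif set0 = 0%E.
Proof. by rewrite /Unif big1 ?mule0// => S _; rewrite measure0. Qed.

Let invC_ge0 : 0 <= 'C(n, t)%:R^-1 :> R. Proof. by rewrite invr_ge0. Qed.

Let Unif_ge0 A : (0 <= Unif A)%E.
Proof. by rewrite mule_ge0 ?lee_fin ?invC_ge0// sume_ge0. Qed.

Let Unif_sigma_additive : semi_sigma_additive Unif.
Proof.
move=> F mF tF mUF.
rewrite [X in X @ _ --> _](_ : _ = fun k => ('C(n, t)%:R^-1%:E *
    \sum_(S : {set 'I_n} | #|S| == t)
      \sum_(0 <= i < k) product_law (coord_law S) (F i))%E).
  apply: cvgeZl => //.
  apply: (@cvg_nnesum _ \oo _ _ _ _ (fun S k =>
    \sum_(0 <= i < k) product_law (coord_law S) (F i))%E).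
    by move=> S _; apply: nearW => k; exact: sume_ge0.
  by move=> S _; exact: measure_semi_sigma_additive.
apply/funext => k; rewrite exchange_big/= ge0_sume_distrr//.
by move=> i _; exact: sume_ge0.
Qed.

HB.instance Definition _ := isMeasure.Build _ _ _ Unif
  Unif0 Unif_ge0 Unif_sigma_additive.

Lemma Unif_setT : Unif setT = (t <= n)%N%:R%:E.
Proof.
rewrite /Unif (eq_bigr (fun=> 1%:E)); last first.
  by move=> S _; exact: probability_setT.
rewrite sumEFin -EFinM sumr_const.
have -> : #|[pred S : {set 'I_n} | #|S| == t]| = 'C(n, t).
  by rewrite -[in RHS](card_ord n) -card_draws cardsE.
have [tn|nt] := leqP t n; last by rewrite bin_small// mulr0n mulr0.
by rewrite mulVf// pnatr_eq0 -lt0n bin_gt0.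
Qed.

Let Unif_le1 : (Unif setT <= 1)%E.
Proof. by rewrite Unif_setT lee_fin lern1 leq_b1. Qed.

HB.instance Definition _ :=
  Measure_isSubProbability.Build _ _ _ Unif Unif_le1.

End Unif.

Arguments Unif {R} n t r A.

Section euclidean.
Context (R : realType) (n : nat).

Definition vec (x : n.-tuple R) : 'cV[R]_n := \col_i tnth x i.

Definition dotv (u v : 'cV[R]_n) : R := \sum_i u i 0 * v i 0.

(* The library norm `|u| on matrices is the sup norm. *)
Definition norm2 (u : 'cV[R]_n) : R := Num.sqrt (dotv u u).

End euclidean.

(* Main.v *)
Require Import Defs.
From HB Require Import structures.
From mathcomp Require Import all_boot all_order all_algebra.
From mathcomp Require Import ring lra zify.

Set Implicit Arguments.
Unset Strict Implicit.
Unset Printing Implicit Defensive.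

Import Order.TTheory GRing.Theory Num.Theory.

Local Open Scope ring_scope.

(* Put M = A^T A - 1, an n x n symmetric matrix with n = s^2, and g = C / s.
   Given the supports S and T of x and y, the bilinear form x^T M y has second
   moment |M_ST|^2 (the squared Frobenius norm of the block) and fourth moment at
   most 25 |M_ST|^4, so it exceeds g |x| |y| in absolute value with probability
   bounded below unless |M_ST|^2 <= 20 g^2 |S| |T|; hence most pairs (S, T) satisfy
   this inequality.

   Taking |S| = 1 and |T| = s shows that, for most rows i, the entries
   min(M_ij^2 / c2, 1) with c2 = 20 (g s)^2 sum to O(s).  Restricted to such rows
   and columns, the sum of these entries over a random block with |S| = |T| = s
   has a variance of the order of its mean, and it is at most 1 for most blocks, so
   its mean is bounded: the sum of min(M_ij^2 / c2, 1) over all pairs is O(n).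
   Thus the graph of the pairs with M_ij^2 >= c2 is sparse and has an independent
   set I of size proportional to n, on which M has squared Frobenius norm
   O(c2 n), with diagonal at most g.  As c2 is small, comparing trace and
   Frobenius norm of the Gram matrix of the columns of A in I bounds m below by a
   multiple of |I|. *)

(** * Sums over random subsets of given size *)

(** Adjoining [B] is a bijection from the subsets of [~: B] of size [t - #|B|] onto the sets counted
    here. *)
Lemma card_supersets_draws (T : finType) (t : nat) (B : {set T}) :
  (#|B| <= t)%N ->
  #|[set S : {set T} | B \subset S & #|S| == t]| = 'C(#|T| - #|B|, t - #|B|).
Proof.
move=> Bt; rewrite -(cardsC B) addKn -cards_draws.
have injU : {in [set A : {set T} | A \subset ~: B & #|A| == (t - #|B|)%N] &,
    injective (fun S => B :|: S)}.
  move=> S1 S2; rewrite !inE => /andP[S1B _] /andP[S2B _] E.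
  have H (S : {set T}) : S \subset ~: B -> (B :|: S) :\: B = S.
    by move=> SB; rewrite setDUl setDv set0U; apply/setDidPl; rewrite disjoints_subset.
  by rewrite -[S1]H// -[S2]H//; congr (_ :\: _).
rewrite -(card_in_imset injU).
apply: eq_card => S; apply/idP/imsetP.
  rewrite inE => /andP[BS /eqP tS]; exists (S :\: B).
    by rewrite inE subsetDr cardsD (setIidPr BS) tS eqxx.
  by rewrite -{1}(setID S B) (setIidPr BS).
move=> [S']; rewrite inE => /andP[S'B /eqP tS'] ->.
rewrite inE subsetUl/= cardsU (_ : B :&: S' = set0) ?cards0 ?subn0 ?tS' ?subnKC//.
by apply/eqP; rewrite setI_eq0 disjoint_sym disjoints_subset.
Qed.

Section draws.
Variables (R : realFieldType) (n t : nat).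

Lemma sum_draws1 : (\sum_(S : {set 'I_n} | #|S| == t) 1 : R) = 'C(n, t)%:R.
Proof.
rewrite sumr_const; congr (_%:R).
by rewrite -[in RHS](card_ord n) -card_draws cardsE.
Qed.

Lemma sum_draws_supset (B : {set 'I_n}) : (#|B| <= t)%N ->
  (\sum_(S : {set 'I_n} | #|S| == t) (B \subset S)%:R : R) =
  'C(n - #|B|, t - #|B|)%:R.
Proof.
move=> Bt; have := card_supersets_draws Bt; rewrite card_ord => <-.
rewrite -sum1_card natr_sum.
rewrite big_mkcond [RHS]big_mkcond/=; apply: eq_bigr => S _.
by rewrite inE; case: (B \subset S); case: (#|S| == t).
Qed.

(** The inclusion probability t/n, with denominators cleared. *)
Lemma sum_draws_mem (i : 'I_n) :
  (\sum_(S : {set 'I_n} | #|S| == t) (i \in S)%:R) * n%:R =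
  t%:R * 'C(n, t)%:R :> R.
Proof.
have [->|t0] := posnP t.
  by rewrite mul0r big1 ?mul0r// => S /eqP/cards0_eq ->; rewrite inE.
under eq_bigr do rewrite -sub1set.
rewrite sum_draws_supset cards1// -!natrM mulnC; congr (_%:R).
by case: t t0 => // u _; rewrite subSS subn0 subn1 mul_bin_diag.
Qed.

(** Negative correlation of inclusions: two distinct points both lie in a random set with
    probability t(t-1)/(n(n-1)), which for t <= n is at most (t/n)^2. *)
Lemma sum_draws_mem2 (i k : 'I_n) : i != k ->
  (\sum_(S : {set 'I_n} | #|S| == t) ((i \in S) && (k \in S))%:R) * n%:R ^+ 2 <=
  t%:R ^+ 2 * 'C(n, t)%:R :> R.
Proof.
move=> ik.
have [t1|t2] := leqP t 1.
  rewrite big1 ?mul0r ?mulr_ge0 ?exprn_ge0// => S /eqP St.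
  case: (boolP (_ && _)) => // /andP[iS kS].
  have : (#|[set i; k]| <= #|S|)%N.
    by apply: subset_leq_card; apply/subsetP => x; rewrite !inE => /orP[]/eqP ->.
  by rewrite cards2 ik St ltnNge t1.
under eq_bigr => S _.
  rewrite (_ : (i \in S) && (k \in S) = ([set i; k] \subset S)); last first.
    by rewrite subUset !sub1set.
  over.
rewrite sum_draws_supset cards2 ik//=.
have n2 : (2 <= n)%N.
  rewrite leqNgt; apply/negP => n1; move/eqP: ik; apply; apply/val_inj => /=.
  by have := ltn_ord i; have := ltn_ord k; lia.
rewrite -!natrX -!natrM ler_nat.
move: n2 t2; clear i k ik; case: n => [//|[//|m]] _; case: t => [//|[//|u]] _.
rewrite !subSS !subn0.
have e1 := mul_bin_diag m.+1 u; have e2 := mul_bin_diag m.+2 u.+1.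
rewrite /= in e1 e2.
have e : (u.+2 * u.+1 * 'C(m.+2, u.+2) = m.+2 * m.+1 * 'C(m, u))%N.
  by rewrite -mulnA mulnCA -e2 mulnCA -e1 mulnA.
have [um|mu] := leqP u m; last by rewrite (bin_small mu).
(* With n = m+2 and t = u+2, this factor reduces the claim to (m+2)(u+1) <= (m+1)(u+2), that is, u
   <= m. *)
rewrite -(leq_pmul2l (m:=m.+1))//.
have -> : (m.+1 * ('C(m, u) * m.+2 ^ 2) = m.+2 * (u.+2 * u.+1 * 'C(m.+2, u.+2)))%N.
  by rewrite e; nia.
nia.
Qed.

End draws.

Section sampling.
Variables (R : realFieldType) (n : nat).
Implicit Types (V : 'I_n -> R) (w : 'I_n -> 'I_n -> R).

Lemma sum_setE V (S : {set 'I_n}) :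
  \sum_(i in S) V i = \sum_i (i \in S)%:R * V i.
Proof.
by rewrite big_mkcond; apply: eq_bigr => i _; case: ifP; rewrite ?mul1r ?mul0r.
Qed.

Lemma draws_mean (t : nat) V :
  (\sum_(S : {set 'I_n} | #|S| == t) \sum_(i in S) V i) * n%:R =
  'C(n, t)%:R * (t%:R * \sum_i V i).
Proof.
under eq_bigr do rewrite sum_setE.
rewrite exchange_big/= mulr_suml !mulr_sumr; apply: eq_bigr => i _.
by rewrite -mulr_suml mulrAC sum_draws_mem; ring.
Qed.

(** After expanding the square, off-diagonal pairs are bounded through [sum_draws_mem2], where V >=
    0 enters. The diagonal terms produce the second summand, the variance term of order t/n. *)
Lemma draws_second_moment (t : nat) V : (forall i, 0 <= V i) ->
  (\sum_(S : {set 'I_n} | #|S| == t) (\sum_(i in S) V i) ^+ 2) * n%:R ^+ 2 <=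
  'C(n, t)%:R *
    (t%:R ^+ 2 * (\sum_i V i) ^+ 2 + t%:R * n%:R * \sum_i V i ^+ 2).
Proof.
move=> V0.
have -> : (\sum_(S : {set 'I_n} | #|S| == t) (\sum_(i in S) V i) ^+ 2) =
    \sum_i \sum_k V i * V k *
      \sum_(S : {set 'I_n} | #|S| == t) ((i \in S) && (k \in S))%:R.
  under eq_bigr => S _.
    rewrite expr2 sum_setE mulr_suml.
    under eq_bigr do rewrite mulr_sumr.
    over.
  rewrite exchange_big/=; apply: eq_bigr => i _.
  rewrite exchange_big/=; apply: eq_bigr => k _.
  rewrite mulr_sumr; apply: eq_bigr => S _.
  by rewrite -mulnb natrM; ring.
rewrite expr2 mulr_suml.
have -> : 'C(n, t)%:R * (t%:R ^+ 2 * ((\sum_i V i) * \sum_i V i) +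
    t%:R * n%:R * \sum_i V i ^+ 2) =
    \sum_i (\sum_k V i * V k * (t%:R ^+ 2 * 'C(n, t)%:R) +
      V i ^+ 2 * (n%:R * (t%:R * 'C(n, t)%:R))).
  rewrite big_split/= -mulr_suml (_ : \sum_i \sum_k _ =
    (\sum_i V i) * (\sum_i V i) * (t%:R ^+ 2 * 'C(n, t)%:R)); first by ring.
  rewrite !mulr_suml; apply: eq_bigr => i _.
  by rewrite mulr_sumr mulr_suml.
apply: ler_sum => i _; rewrite mulr_suml.
rewrite (bigD1 i)//= [in leRHS](bigD1 i)//= addrAC; apply: lerD; last first.
  apply: ler_sum => k ki; rewrite -!mulrA; apply: ler_wpM2l => //.
  apply: ler_wpM2l => //.
  have ik : i != k by rewrite eq_sym.
  by have := sum_draws_mem2 R t ik; rewrite !expr2 !mulrA.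
under eq_bigr do rewrite andbb.
rewrite -(sum_draws_mem R t i).
set x := \sum_(S | _) _; have x0 : 0 <= x by apply: sumr_ge0.
have -> : V i * V i * x * (n%:R * n%:R) = V i ^+ 2 * (n%:R * (x * n%:R)) by ring.
by rewrite lerDr !mulr_ge0// exprn_ge0.
Qed.

End sampling.

(** Chebyshev's argument read backwards: on a fraction p of the points f <= 1, so f deviates from
    its mean by at least mu - 1 there, while the variance is at most H mu. This bounds mu in terms
    of p and H. *)
Lemma second_moment_concentration (R : realFieldType) (I : finType) (P : pred I)
    (f : I -> R) (N mu H p : R) :
  N = \sum_(i | P i) 1 -> 0 < N ->
  \sum_(i | P i) f i = N * mu ->
  \sum_(i | P i) f i ^+ 2 <= N * (mu ^+ 2 + H * mu) ->
  p * N <= \sum_(i | P i) (f i <= 1)%R%:R -> 1 <= mu ->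
  p * (mu - 1) ^+ 2 <= H * mu.
Proof.
move=> NE N0 f1 f2 fp mu1; rewrite -(ler_pM2r N0).
have : \sum_(i | P i) (f i <= 1)%R%:R * (mu - 1) ^+ 2 <=
    \sum_(i | P i) (f i - mu) ^+ 2.
  apply: ler_sum => i _; case: (leP (f i) 1) => fi; last by rewrite /= mulr0n mul0r sqr_ge0.
  by rewrite /= mul1r; nra.
rewrite -mulr_suml.
have -> : \sum_(i | P i) (f i - mu) ^+ 2 =
    \sum_(i | P i) f i ^+ 2 - 2 * mu * (N * mu) + mu ^+ 2 * N.
  rewrite -f1 NE !mulr_sumr -sumrB -big_split/=; apply: eq_bigr => i _; ring.
have := ler_wpM2r (sqr_ge0 (mu - 1)) fp.
move=> h1 h2; have := le_trans h1 h2; nra.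
Qed.

Section sampled_sums.
Variables (R : realFieldType) (n : nat).
Implicit Types (V : 'I_n -> R) (w : 'I_n -> 'I_n -> R).

(** As V^2 <= V, the sampled sum has variance at most its mean mu. Concentration with p = 1/4 and H
    = 1 gives (mu - 1)^2 <= 4 mu, hence mu < 6. *)
Lemma sum_le_of_sampled (t : nat) V : (0 < n)%N -> (t <= n)%N ->
  (forall i, 0 <= V i <= 1) ->
  4^-1 * 'C(n, t)%:R <=
    \sum_(S : {set 'I_n} | #|S| == t) (\sum_(i in S) V i <= 1)%R%:R :> R ->
  t%:R * \sum_i V i <= 6 * n%:R.
Proof.
move=> n0 tn V01 hp; have nR : (0 : R) < n%:R by rewrite ltr0n.
have V0 i : 0 <= V i by case/andP: (V01 i).
set mu := t%:R * (\sum_i V i) / n%:R.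
rewrite -ler_pdivrMr// -/mu; have [|mu1] := leP mu 1; first lra.
have C0 : (0 : R) < 'C(n, t)%:R by rewrite ltr0n bin_gt0.
have h1 : \sum_(S : {set 'I_n} | #|S| == t) \sum_(i in S) V i =
    'C(n, t)%:R * mu.
  apply: (mulIf (lt0r_neq0 nR)); rewrite draws_mean /mu; field.
  by rewrite lt0r_neq0.
have h2 : \sum_(S : {set 'I_n} | #|S| == t) (\sum_(i in S) V i) ^+ 2 <=
    'C(n, t)%:R * (mu ^+ 2 + 1 * mu).
  rewrite -(ler_pM2r (exprn_gt0 2 nR)); apply: le_trans (draws_second_moment t V0) _.
  rewrite -[leRHS]mulrA; apply: ler_wpM2l; first exact: ltW.
  have -> : (mu ^+ 2 + 1 * mu) * n%:R ^+ 2 =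
    t%:R ^+ 2 * (\sum_i V i) ^+ 2 + t%:R * n%:R * \sum_i V i.
    by rewrite /mu; field; rewrite lt0r_neq0.
  rewrite lerD2l; apply: ler_wpM2l; first by rewrite mulr_ge0.
  by apply: ler_sum => i _; have := V01 i; nra.
have := second_moment_concentration (esym (sum_draws1 _ _ _)) C0 h1 h2 hp (ltW mu1).
by nra.
Qed.

(** The variance over both samples has a part from row sums, one from column sums and one from
    single entries. The bounds 6s make these at most 6 mu, 6 mu and mu, so H = 13, and 0.72 (mu -
    1)^2 <= 13 mu forces mu < 21. *)
Lemma bisum_le_of_sampled (s : nat) w : n = (s ^ 2)%N -> (0 < s)%N ->
  (forall i j, 0 <= w i j <= 1) ->
  (forall i, \sum_j w i j <= 6 * s%:R) ->
  (forall j, \sum_i w i j <= 6 * s%:R) ->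
  72 / 100 * 'C(n, s)%:R ^+ 2 <=
    \sum_(S : {set 'I_n} | #|S| == s) \sum_(T : {set 'I_n} | #|T| == s)
      (\sum_(i in S) \sum_(j in T) w i j <= 1)%R%:R :> R ->
  \sum_i \sum_j w i j <= 21 * n%:R.
Proof.
move=> nE s0 w01 wr wc hp.
have w0 i j : 0 <= w i j by case/andP: (w01 i j).
have nR : (n%:R : R) = s%:R ^+ 2 by rewrite nE natrX.
have sR : (0 : R) < s%:R by rewrite ltr0n.
have sR0 := lt0r_neq0 sR.
have sn : (s <= n)%N by rewrite nE expnS expn1 leq_pmulr.
set mu := (\sum_i \sum_j w i j) / n%:R.
have n0 : (0 : R) < n%:R by rewrite nR exprn_gt0.
rewrite -ler_pdivrMr// -/mu; have [|mu1] := leP mu 1; first lra.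
have sumE : \sum_i \sum_j w i j = mu * s%:R ^+ 2.
  by rewrite /mu nR divfK// expf_neq0.
clearbody mu.
set C := 'C(n, s)%:R in hp *.
have C0 : (0 : R) < C by rewrite ltr0n bin_gt0.
have nn0 : (n%:R : R) ^+ 2 = s%:R ^+ 4 by rewrite nR; ring.
pose u (S : {set 'I_n}) j := \sum_(i in S) w i j.
have u0 S j : 0 <= u S j by apply: sumr_ge0.
have uE (S T : {set 'I_n}) : \sum_(i in S) \sum_(j in T) w i j = \sum_(j in T) u S j.
  by rewrite exchange_big.
have suE (S : {set 'I_n}) : \sum_j u S j = \sum_(i in S) \sum_j w i j.
  by rewrite exchange_big.
pose P (p : {set 'I_n} * {set 'I_n}) := (#|p.1| == s) && (#|p.2| == s).
pose f (p : {set 'I_n} * {set 'I_n}) := \sum_(i in p.1) \sum_(j in p.2) w i j.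
have NE : C ^+ 2 = \sum_(p | P p) 1.
  rewrite -(pair_big (fun S : {set 'I_n} => #|S| == s)
    (fun S : {set 'I_n} => #|S| == s) (fun _ _ => 1))/=.
  under eq_bigr do rewrite sum_draws1 -[_%:R]mul1r.
  by rewrite -mulr_suml sum_draws1 expr2.
have h1 : \sum_(p | P p) f p = C ^+ 2 * mu.
  rewrite -(pair_big (fun S : {set 'I_n} => #|S| == s)
    (fun S : {set 'I_n} => #|S| == s)
    (fun S T => \sum_(i in S) \sum_(j in T) w i j))/=.
  apply: (mulIf (lt0r_neq0 n0)); rewrite mulr_suml.
  under eq_bigr => S _.
    under eq_bigr do rewrite uE.
    rewrite draws_mean suE.
    over.
  rewrite -!mulr_sumr; apply: (mulIf (lt0r_neq0 n0)).
  rewrite -!mulrA draws_mean sumE nR -/C; ring.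
have h2 : \sum_(p | P p) f p ^+ 2 <= C ^+ 2 * (mu ^+ 2 + 13 * mu).
  rewrite -(pair_big (fun S : {set 'I_n} => #|S| == s)
    (fun S : {set 'I_n} => #|S| == s)
    (fun S T => (\sum_(i in S) \sum_(j in T) w i j) ^+ 2))/=.
  rewrite -(ler_pM2r (exprn_gt0 2 n0)) -(ler_pM2r (exprn_gt0 2 n0)) mulr_suml.
  (* The second moment over [T] is taken for each fixed [S]. The outer sum over [S] is then treated
     by the same lemma, applied to the row sums in [a1] and to each column in [a2]. *)
  have step1 : \sum_(S : {set 'I_n} | #|S| == s)
      (\sum_(T : {set 'I_n} | #|T| == s) (\sum_(i in S) \sum_(j in T) w i j) ^+ 2)
       * n%:R ^+ 2 <= C * (s%:R ^+ 2 *
         (\sum_(S : {set 'I_n} | #|S| == s) (\sum_(i in S) \sum_j w i j) ^+ 2) +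
         s%:R * n%:R * \sum_j \sum_(S : {set 'I_n} | #|S| == s) u S j ^+ 2).
    rewrite exchange_big/= !mulr_sumr -big_split/= mulr_sumr; apply: ler_sum => S _.
    rewrite -suE; under eq_bigr do rewrite uE.
    exact: draws_second_moment.
  rewrite -(ler_pM2r (exprn_gt0 2 n0)) in step1.
  apply: le_trans step1 _.
  have a1 := @draws_second_moment R n s (fun i => \sum_j w i j)
    (fun i => sumr_ge0 _ (fun j _ => w0 i j)).
  have a2 : (\sum_j \sum_(S : {set 'I_n} | #|S| == s) u S j ^+ 2) * n%:R ^+ 2 <=
      C * (s%:R ^+ 2 * \sum_j (\sum_i w i j) ^+ 2 +
           s%:R * n%:R * \sum_j \sum_i w i j ^+ 2).
    rewrite !mulr_sumr -big_split/= mulr_sumr mulr_suml; apply: ler_sum => j _.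
    exact: draws_second_moment.
  have b (v : 'I_n -> 'I_n -> R) : (forall i j, 0 <= v i j) ->
      (forall i, \sum_j v i j <= 6 * s%:R) ->
      \sum_i (\sum_j v i j) ^+ 2 <= 6 * s%:R * \sum_i \sum_j v i j.
    move=> v0 v6; rewrite mulr_sumr; apply: ler_sum => i _; rewrite expr2.
    by apply: ler_wpM2r => //; apply: sumr_ge0.
  have b1 : \sum_i (\sum_j w i j) ^+ 2 <= 6 * s%:R * (mu * s%:R ^+ 2).
    by rewrite -sumE; exact: b.
  have b2 : \sum_j (\sum_i w i j) ^+ 2 <= 6 * s%:R * (mu * s%:R ^+ 2).
    by rewrite -sumE exchange_big/=; exact: (b (fun j i => w i j)).
  have b3 : \sum_j \sum_i w i j ^+ 2 <= mu * s%:R ^+ 2.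
    rewrite -sumE [leRHS]exchange_big/=.
    by apply: ler_sum => j _; apply: ler_sum => i _; have := w01 i j; nra.
  rewrite sumE -/C in a1.
  move: a1 a2 b1 b2 b3; rewrite nn0 nR.
  set A1 := \sum_(S : {set 'I_n} | _) (\sum_(i in S) \sum_j w i j) ^+ 2.
  set A2 := \sum_j \sum_(S : {set 'I_n} | _) _.
  set B1 := \sum_i (\sum_j w i j) ^+ 2; set B2 := \sum_j (\sum_i w i j) ^+ 2.
  set B3 := \sum_j \sum_i _ ^+ 2.
  move=> a1 a2 b1 b2 b3.
  have -> : C * (s%:R ^+ 2 * A1 + s%:R * s%:R ^+ 2 * A2) * s%:R ^+ 4 =
    C * (s%:R ^+ 2 * (A1 * s%:R ^+ 4) + s%:R ^+ 3 * (A2 * s%:R ^+ 4)) by ring.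
  have c2 : 0 <= s%:R ^+ 2 :> R by rewrite exprn_ge0.
  have c3 : 0 <= s%:R ^+ 3 :> R by rewrite exprn_ge0.
  have := lerD (ler_wpM2l c2 a1) (ler_wpM2l c3 a2).
  move=> /(ler_wpM2l (ltW C0))/le_trans; apply.
  have c4 : 0 <= s%:R ^+ 4 :> R by rewrite exprn_ge0.
  have c5 : 0 <= s%:R ^+ 5 :> R by rewrite exprn_ge0.
  have c6 : 0 <= s%:R ^+ 6 :> R by rewrite exprn_ge0.
  (* These weights turn the three bounds into (6 + 6 + 1) mu s^8, where s^8 = n^4. *)
  have := lerD (lerD (ler_wpM2l c5 b1) (ler_wpM2l c5 b2)) (ler_wpM2l c6 b3).
  move=> h; have h' := ler_wpM2l (ltW C0) (ler_wpM2l (ltW C0) h).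
  rewrite -subr_ge0 in h'; rewrite -subr_ge0; apply: le_trans h' _.
  by rewrite le_eqVlt; apply/orP; left; apply/eqP; ring.
have h3 : 72 / 100 * C ^+ 2 <= \sum_(p | P p) (f p <= 1)%R%:R.
  by rewrite -(pair_big (fun S : {set 'I_n} => #|S| == s)
    (fun S : {set 'I_n} => #|S| == s)
    (fun S T => (\sum_(i in S) \sum_(j in T) w i j <= 1)%R%:R : R)).
have := second_moment_concentration NE (exprn_gt0 2 C0) h1 h2 h3 (ltW mu1).
by nra.
Qed.

End sampled_sums.

(** * Submatrices and rank *)

(** Greedy choice: each chosen vertex removes itself and its neighbours, at most d + 1 vertices of
    [H]. *)
Lemma large_independent_set (T : finType) (e : rel T) (d : nat) (H : {set T}) :
  symmetric e -> (forall i, i \in H -> (#|[set j in H | e i j]| <= d)%N) ->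
  exists2 I : {set T}, I \subset H &
    {in I &, forall i j, i != j -> ~~ e i j} /\ (#|H| <= #|I| * d.+1)%N.
Proof.
move=> se; have [k] := ubnP #|H|; elim: k H => // k IH H Hk Hd.
have [->|/set0Pn[v vH]] := eqVneq H set0.
  by exists set0; rewrite ?sub0set// cards0; split => // i j; rewrite inE.
pose N := v |: [set j in H | e v j].
have NH : N \subset H by apply/subsetP => x; rewrite !inE => /orP[/eqP->//|/andP[]].
have NP : (0 < #|N|)%N by apply/card_gt0P; exists v; rewrite !inE eqxx.
have cN : (#|N| <= d.+1)%N.
  by rewrite cardsU1; have := Hd v vH; case: (_ \notin _); lia.
have cD : #|H :\: N| = (#|H| - #|N|)%N by rewrite cardsD (setIidPr NH).
have [|i|I IH' [Ie cI]] := IH (H :\: N).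
- by rewrite cD; have := subset_leq_card NH; lia.
- rewrite inE => /andP[_ iH]; apply: leq_trans (Hd i iH).
  by apply: subset_leq_card; apply/subsetP => x; rewrite !inE => /andP[/andP[_ ->]].
have ID x : x \in I -> [/\ x \in H, x != v & ~~ e v x].
  by move=> /(subsetP IH'); rewrite !inE negb_or => /andP[/andP[xv +] xH]; rewrite xH.
exists (v |: I).
  apply/subsetP => x; rewrite !inE => /orP[/eqP->//|/ID[]//].
split.
  move=> i j; rewrite !inE => /orP[/eqP->|iI] /orP[/eqP->|jI] ij.
  - by rewrite eqxx in ij.
  - by have [] := ID j jI.
  - by rewrite se; have [] := ID i iI.
  - exact: Ie.
have -> : #|v |: I| = #|I|.+1.
  rewrite cardsU1; case: (boolP (v \in I)) => //= /ID[_].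
  by rewrite eqxx.
by rewrite mulSn; have := subset_leq_card NH; lia.
Qed.

Section gram.
Variables (R : realFieldType) (m k : nat).

Lemma sum_sqr_le (x : 'I_m -> R) :
  (\sum_a x a) ^+ 2 <= m%:R * \sum_a x a ^+ 2.
Proof.
have : 0 <= \sum_a \sum_b (x a - x b) ^+ 2.
  by apply: sumr_ge0 => a _; apply: sumr_ge0 => b _; exact: sqr_ge0.
have -> : \sum_a \sum_b (x a - x b) ^+ 2 =
    2 * (m%:R * \sum_a x a ^+ 2) - 2 * (\sum_a x a) ^+ 2.
  transitivity (\sum_a (m%:R * x a ^+ 2 + \sum_b x b ^+ 2 -
      2 * (x a * \sum_b x b))).
    apply: eq_bigr => a _; rewrite [m%:R * _]mulr_natl -[in _ *+ m](card_ord m).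
    rewrite -sumr_const !mulr_sumr -big_split/= -sumrB.
    by apply: eq_bigr => b _; ring.
  rewrite sumrB big_split/= -!mulr_sumr -mulr_suml sumr_const card_ord.
  by rewrite -[_ *+ m]mulr_natl; ring.
lra.
Qed.

(* The Gram matrices [U^T *m U] and [U *m U^T] have the same trace and the same
   Frobenius norm. *)
Lemma gram_trace_sqr_le (U : 'M[R]_(m, k)) :
  (\tr (U^T *m U)) ^+ 2 <= m%:R * \sum_i \sum_j (U^T *m U) i j ^+ 2.
Proof.
have frob q (B : 'M[R]_q) : B^T = B -> \sum_i \sum_j B i j ^+ 2 = \tr (B *m B).
  move=> BT; apply: eq_bigr => i _; rewrite mxE; apply: eq_bigr => j _.
  by rewrite -[in X in _ * X]BT mxE expr2.
have -> : \sum_i \sum_j (U^T *m U) i j ^+ 2 = \sum_i \sum_j (U *m U^T) i j ^+ 2.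
  rewrite !frob ?trmx_mul ?trmxK// -!mulmxA mxtrace_mulC.
  by rewrite !mulmxA.
rewrite mxtrace_mulC; apply: le_trans (sum_sqr_le _) _.
apply: ler_wpM2l => //; apply: ler_sum => a _; rewrite (bigD1 a)//= lerDl.
by apply: sumr_ge0 => b _; exact: sqr_ge0.
Qed.

End gram.

Section good_submatrix.
Variables (R : realFieldType) (s : nat).
Local Notation n := (s ^ 2)%N.
Variables (M : 'I_n -> 'I_n -> R) (gamma c2 : R).

(* The truncations [min(M_ij^2 s/c2, 1)] and [min(M_ij^2/c2, 1)] have bounded
   second moment under sampling, so the hypotheses, which control typical
   samples, control their sums; an entry with [M_ij^2 >= c2] contributes [1]
   to the second sum, so few of them have to be avoided. *)
Lemma good_submatrix :
  (0 < s)%N -> 0 < c2 -> (forall i j, M i j = M j i) ->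
  99 / 100 * n%:R <= \sum_i (`|M i i| <= gamma)%R%:R :> R ->
  72 / 100 * (n%:R * 'C(n, s)%:R) <=
    \sum_i \sum_(T : {set 'I_n} | #|T| == s)
      (\sum_(j in T) M i j ^+ 2 <= c2 / s%:R)%R%:R :> R ->
  72 / 100 * 'C(n, s)%:R ^+ 2 <=
    \sum_(S : {set 'I_n} | #|S| == s) \sum_(T : {set 'I_n} | #|T| == s)
      (\sum_(i in S) \sum_(j in T) M i j ^+ 2 <= c2)%R%:R :> R ->
  exists I : {set 'I_n}, [/\ 40 / 100 * n%:R <= 101 * #|I|%:R :> R,
    forall i, i \in I -> `|M i i| <= gamma &
    \sum_(i in I) \sum_(j in I | j != i) M i j ^+ 2 <= c2 * (21 * n%:R)].
Proof.
move=> s0 c20 Msym diag_ok row_ok block_ok.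
have s1 : 1 <= s%:R :> R by rewrite ler1n.
have sR : 0 < s%:R :> R by rewrite ltr0n.
have nR : (n%:R : R) = s%:R ^+ 2 by rewrite natrX.
have n0 : 0 < n%:R :> R by rewrite nR exprn_gt0.
have nat0 : (0 < n)%N by rewrite expn_gt0 s0.
have sn : (s <= n)%N by rewrite expnS expn1 leq_pmulr.
pose V i j := Num.min (M i j ^+ 2 * (s%:R / c2)) 1.
pose W i j := Num.min (M i j ^+ 2 / c2) 1.
have sq0 i j : 0 <= M i j ^+ 2 by exact: sqr_ge0.
have V01 i j : 0 <= V i j <= 1.
  by rewrite le_min ler01 mulr_ge0//= ?ge_min ?lexx ?orbT// divr_ge0// ltW.
have W01 i j : 0 <= W i j <= 1.
  by rewrite le_min ler01 divr_ge0//= ?ge_min ?lexx ?orbT// ltW.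
have WV i j : W i j <= V i j.
  rewrite le_min !ge_min lexx !orbT andbT; apply/orP; left.
  have -> : M i j ^+ 2 * (s%:R / c2) = s%:R * (M i j ^+ 2 / c2) by ring.
  by rewrite ler_peMl// divr_ge0// ltW.
move: row_ok block_ok.
set C : R := 'C(n, s)%:R => row_okC block_okC.
have C0 : 0 < C by rewrite ltr0n bin_gt0.
pose p i : R := \sum_(T : {set 'I_n} | #|T| == s) (\sum_(j in T) V i j <= 1)%R%:R.
(* The threshold 1/4 is the one required by [sum_le_of_sampled]. *)
pose g i := 4^-1 * C <= p i.
pose G := [set i | g i & `|M i i| <= gamma].
have pC i : p i <= C.
  rewrite /C -sum_draws1; apply: ler_sum => T _.
  by rewrite (lern1 R) leq_b1.
have p_ok : 72 / 100 * (n%:R * C) <= \sum_i p i.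
  apply: le_trans row_okC _; apply: ler_sum => i _; apply: ler_sum => T _.
  rewrite ler_nat; case: (leP (\sum_(j in T) M i j ^+ 2) (c2 / s%:R)) => // h.
  rewrite lt0b; have: \sum_(j in T) M i j ^+ 2 * (s%:R / c2) <= 1.
    rewrite -mulr_suml; apply: le_trans (ler_wpM2r _ h) _.
      by rewrite divr_ge0// ltW.
    by rewrite mulrA divfK ?divff// lt0r_neq0.
  by apply: le_trans; apply: ler_sum => j _; rewrite ge_min lexx.
have sum1n : \sum_(i : 'I_n) 1 = n%:R :> R by rewrite sumr_const card_ord.
(* Markov's inequality: p / C is at most 1 on good rows and below 1/4 on the others, with average at
   least 0.72, so good rows have density at least (0.72 - 0.25) / 0.75 = 47/75. *)
have g_ok : 47 / 75 * n%:R <= \sum_i (g i)%:R :> R.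
  have : \sum_i p i <= \sum_i ((g i)%:R * (3 / 4) + 4^-1) * C.
    apply: ler_sum => i _; case: (boolP (g i)) => [_|].
      by rewrite /= mul1r; apply: le_trans (pC i) _; lra.
    by rewrite /g -ltNge /= => /ltW; lra.
  rewrite -mulr_suml big_split/= -mulr_suml.
  have -> : \sum_(i < n) 4^-1 = 4^-1 * n%:R :> R.
    by rewrite -sum1n mulr_sumr; under [RHS]eq_bigr do rewrite mulr1.
  move=> /(le_trans p_ok); rewrite mulrA ler_pM2r//; lra.
(* At most 1/100 of the rows are lost to a large diagonal entry. *)
have G_ok : 61 / 100 * n%:R <= \sum_i (i \in G)%:R :> R.
  have : \sum_i ((g i)%:R + (`|M i i| <= gamma)%R%:R - 1) <= \sum_i (i \in G)%:R :> R.
    apply: ler_sum => i _; rewrite inE.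
    by case: (g i); case: (_ <= gamma); rewrite /=; lra.
  by rewrite sumrB big_split/= sum1n; move: diag_ok g_ok n0; lra.
have Grow i : i \in G -> \sum_j V i j <= 6 * s%:R.
  rewrite inE => /andP[gi _].
  have := sum_le_of_sampled (R := R) nat0 sn (V01 i) gi.
  rewrite nR.
  have -> : 6 * s%:R ^+ 2 = s%:R * (6 * s%:R) :> R by ring.
  by rewrite ler_pM2l.
(* Zeroing entries outside [G] x [G] makes the row bound hold for every index, and can only decrease
   block sums. *)
pose w i j := if (i \in G) && (j \in G) then W i j else 0.
have w01 i j : 0 <= w i j <= 1.
  by rewrite /w; case: ifP; rewrite ?W01 ?lexx ?ler01.
have wsym i j : w i j = w j i by rewrite /w andbC /W Msym.
have wr i : \sum_j w i j <= 6 * s%:R.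
  case: (boolP (i \in G)) => iG; last first.
    by rewrite big1 ?mulr_ge0// => j _; rewrite /w (negbTE iG).
  apply: le_trans (Grow i iG); apply: ler_sum => j _; apply: le_trans (WV i j).
  by rewrite /w; case: ifP => // _; case/andP: (W01 i j).
have wc j : \sum_i w i j <= 6 * s%:R by under eq_bigr do rewrite wsym; exact: wr.
have w_ok : \sum_i \sum_j w i j <= 21 * n%:R.
  apply: (bisum_le_of_sampled (erefl n) s0 w01 wr wc).
  apply: le_trans block_okC _; apply: ler_sum => S _; apply: ler_sum => T _.
  rewrite ler_nat; case: (leP (\sum_(i in S) \sum_(j in T) M i j ^+ 2) c2) => // h.
  rewrite lt0b; have: \sum_(i in S) \sum_(j in T) M i j ^+ 2 / c2 <= 1.
    under eq_bigr do rewrite -mulr_suml.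
    by rewrite -mulr_suml ler_pdivrMr// mul1r.
  apply: le_trans; apply: ler_sum => i _; apply: ler_sum => j _.
  apply: (@le_trans _ _ (W i j)); last by rewrite ge_min lexx.
  by rewrite /w; case: ifP => // _; case/andP: (W01 i j).
(* As [w] has total at most 21 n, at most 0.21 n rows have sum above 100, which leaves 0.61 - 0.21 =
   0.40. *)
pose H := [set i in G | \sum_j w i j <= 100].
have H_ok : 40 / 100 * n%:R <= #|H|%:R :> R.
  rewrite -sum1_card natr_sum big_mkcond/=.
  have : \sum_i ((i \in G)%:R - 100^-1 * \sum_j w i j) <=
      \sum_i (if i \in H then 1 else 0) :> R.
    apply: ler_sum => i _; rewrite [i \in H]inE.
    have : 0 <= \sum_j w i j by apply: sumr_ge0 => j _; case/andP: (w01 i j).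
    by case: (i \in G) => /=; case: (leP (\sum_j w i j) 100) => /=; lra.
  by rewrite sumrB -mulr_sumr; lra.
(* Each edge inside [H] contributes 1 to a row sum of [w], so degrees in [H] are at most 100. *)
pose e i j := c2 <= M i j ^+ 2.
have esym : symmetric e by move=> i j; rewrite /e Msym.
have wE i j : i \in G -> j \in G -> w i j = W i j.
  by move=> iG jG; rewrite /w iG jG.
have HG i : i \in H -> i \in G by rewrite inE => /andP[].
have Hd i : i \in H -> (#|[set j in H | e i j]| <= 100)%N.
  move=> iH; rewrite -(ler_nat R); move: (iH); rewrite inE => /andP[_].
  apply: le_trans; rewrite -sum1_card natr_sum big_mkcond/=.
  apply: ler_sum => j _; rewrite inE; case: ifP => [/andP[jH eij]|_]; last first.
    by case/andP: (w01 i j).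
  by rewrite wE ?HG// le_min lexx andbT ler_pdivlMr// mul1r.
have [I IH [Ie cI]] := large_independent_set esym Hd.
have {}cI : 40 / 100 * n%:R <= 101 * #|I|%:R :> R.
  by apply: le_trans H_ok _; rewrite -natrM ler_nat mulnC.
exists I; split => //.
  by move=> i /(subsetP IH)/HG; rewrite inE => /andP[].
(* Off the diagonal of [I] there are no edges, so the truncation in [W] is inactive and M_ij^2 = c2
   w_ij. *)
apply: (@le_trans _ _ (\sum_i \sum_j c2 * w i j)); last first.
  under eq_bigr do rewrite -mulr_sumr.
  by rewrite -mulr_sumr ler_pM2l.
have w0 i j : 0 <= c2 * w i j by case/andP: (w01 i j) => *; rewrite mulr_ge0// ltW.
rewrite big_mkcond/=; apply: ler_sum => i _; case: ifPn => [iI|_]; last exact: sumr_ge0.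
rewrite big_mkcond/=; apply: ler_sum => j _; case: ifPn => [/andP[jI ji]|_//].
have iG := HG _ (subsetP IH _ iI); have jG := HG _ (subsetP IH _ jI).
have ij : i != j by rewrite eq_sym.
have := Ie i j iI jI ij; rewrite /e -ltNge => /ltW h.
rewrite wE// /W min_l; last by rewrite ler_pdivrMr// mul1r.
by rewrite mulrC divfK// lt0r_neq0.
Qed.

End good_submatrix.

Section rank_bound.
Variables (R : realFieldType) (s m : nat).
Local Notation n := (s ^ 2)%N.
Variables (A : 'M[R]_(m, n)) (gamma c2 : R) (I : {set 'I_n}).
Let M i j := (A^T *m A) i j - (i == j)%:R.

(** The Gram matrix of the columns in [I] has trace at least 0.999 |I| and squared Frobenius norm at
    most 1.2 |I|, so [gram_trace_sqr_le] bounds m below by a multiple of |I|. *)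
Lemma rank_bound : (0 < s)%N -> 0 <= gamma <= 1000^-1 ->
  0 <= c2 <= 2 / (1000 * 100) ->
  40 / 100 * n%:R <= 101 * #|I|%:R :> R ->
  (forall i, i \in I -> `|M i i| <= gamma) ->
  \sum_(i in I) \sum_(j in I | j != i) M i j ^+ 2 <= c2 * (21 * n%:R) ->
  n%:R / 1000 <= m%:R :> R.
Proof.
move=> s0 /andP[g0 g1] /andP[c20 c21] cI Idiag Ioff.
have n0 : 0 < n%:R :> R by rewrite ltr0n expn_gt0 s0.
(* Columns outside [I] are zeroed rather than deleted: trace and Frobenius norm of the Gram matrix
   are the same, and the indices stay in ['I_n]. *)
pose U : 'M[R]_(m, n) := \matrix_(a, i) (if i \in I then A a i else 0).
have UE i j : (U^T *m U) i j =
    if (i \in I) && (j \in I) then M i j + (i == j)%:R else 0.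
  rewrite /M subrK !mxE; under eq_bigr do rewrite !mxE.
  case: (i \in I); case: (j \in I) => /=.
  - by apply: eq_bigr => a _; rewrite mxE.
  - by apply: big1 => a _; rewrite mulr0.
  - by apply: big1 => a _; rewrite mul0r.
  - by apply: big1 => a _; rewrite mul0r.
have tr_ok : 999 / 1000 * #|I|%:R <= \tr (U^T *m U).
  rewrite -sum1_card natr_sum mulr_sumr big_mkcond/=.
  apply: ler_sum => i _; rewrite UE andbb eqxx; case: ifP => // /Idiag.
  by rewrite ler_norml mulr1 /=; move: (M i i) => x; lra.
have frob_ok : \sum_i \sum_j (U^T *m U) i j ^+ 2 <=
    1003 / 1000 * #|I|%:R + c2 * (21 * n%:R).
  apply: le_trans (lerD (lexx _) Ioff).
  rewrite -sum1_card natr_sum mulr_sumr -big_split/= [leRHS]big_mkcond/=.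
  apply: ler_sum => i _; case: (boolP (i \in I)) => [iI|iI]; last first.
    by rewrite /= big1 ?lexx// => j _; rewrite UE (negbTE iI) expr0n.
  rewrite (bigD1 i)//=; apply: lerD.
    rewrite UE andbb iI eqxx; have := Idiag i iI.
    rewrite ler_norml mulr1 /=; move: (M i i) => x /andP[x1 x2].
    have x3 : `|x + 1| <= 1001 / 1000 by rewrite ler_norml; apply/andP; split; lra.
    rewrite -[leLHS]real_normK ?num_real//.
    apply: (@le_trans _ _ ((1001 / 1000) ^+ 2)); last lra.
    by rewrite ler_pXn2r ?nnegrE ?normr_ge0//; lra.
  rewrite big_mkcond [leRHS]big_mkcond/=; apply: ler_sum => j _.
  rewrite UE iI/=; case: (boolP (j \in I)) => [jI|jI] /=; last first.
    by case: ifP; rewrite ?expr0n.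
  by case: ifPn => // ji; rewrite eq_sym (negbTE ji) addr0.
have := gram_trace_sqr_le U; move: tr_ok frob_ok.
set t := \tr _; set f := \sum_i _; move: n0 cI.
have : 0 <= m%:R :> R by [].
move: (m%:R : R) (n%:R : R) (#|I|%:R : R) => m' n' k.
clear - c20 c21 => m0 n0 cI tr_ok frob_ok h.
rewrite leNgt; apply/negP => mn.
have k0 : 0 < k by lra.
have h1 : (999 / 1000 * k) ^+ 2 <= t ^+ 2.
  by rewrite ler_pXn2r// nnegrE; lra.
have cn : c2 * (21 * n') <= 2 / (1000 * 100) * (21 * n').
  by apply: ler_wpM2r => //; lra.
have h2 : f <= 12 / 10 * k by lra.
have h3 : m' * f <= (n' / 1000) * (12 / 10 * k).
  apply: le_trans (ler_wpM2l m0 h2) _; apply: ler_wpM2r; last exact: ltW.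
  lra.
(* From n <= (101 / 0.4) k = 252.5 k. The contradiction is then 0.998 k^2 <= 253 (1.2 / 1000)
   k^2. *)
have h4 : n' * k <= 253 * k * k by apply: ler_wpM2r; lra.
have h5 := le_trans h1 (le_trans h h3).
have h6 : 0 < k * k by rewrite mulr_gt0.
rewrite expr2 in h5; nra.
Qed.

End rank_bound.

From mathcomp Require Import all_classical all_reals all_analysis.
From mathcomp Require Import measurable_realfun.

Import numFieldNormedType.Exports.

Local Open Scope classical_set_scope.
Local Open Scope ring_scope.

(** * Gaussian moments *)

Section gaussian_moments.
Context {R : realType}.
Local Notation mu := lebesgue_measure.
Local Notation gauss := (normal_prob 0 1 : probability (measurableTypeR R) R).

Import HBNNSimple.

(** For indicators this is the definition of the law by its density. It extends to simple functions
    by linearity and to all nonnegative [f] by monotone convergence. *)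
Lemma ge0_integral_normal_prob (m s : R) (f : measurableTypeR R -> \bar R) :
  measurable_fun [set: measurableTypeR R] f -> (forall x, 0 <= f x)%E ->
  (\int[normal_prob m s]_x f x = \int[mu]_x (f x * (normal_pdf m s x)%:E))%E.
Proof.
move=> mf f0; pose g := nnsfun_approx measurableT mf.
have mpdf : measurable_fun setT (EFin \o normal_pdf m s).
  by apply/measurable_EFinP; exact: measurable_normal_pdf.
have pdf0 x : (0 <= (normal_pdf m s x)%:E)%E by rewrite lee_fin normal_pdf_ge0.
have fE x : f x = limn (EFin \o g ^~ x).
  by apply/esym/cvg_lim => //; exact: cvg_nnsfun_approx.
transitivity (limn (fun n => \int[normal_prob m s]_x (g n x)%:E)%E).
  rewrite -monotone_convergence//.
  - by apply: eq_integral => x _; rewrite fE.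
  - by move=> n; exact/measurable_EFinP.
  - by move=> n x _; rewrite lee_fin.
  - by move=> x _ a b ab; rewrite lee_fin; exact/lefP/nd_nnsfun_approx.
transitivity (limn (fun n => \int[mu]_x ((g n x)%:E * (normal_pdf m s x)%:E))%E);
    last first.
  rewrite -monotone_convergence//.
  - apply: eq_integral => x _; rewrite fE.
    rewrite (_ : (fun n => _) = (fun n => (EFin \o g^~ x) n * (normal_pdf m s x)%:E)%E)//.
    apply/cvg_lim => //; apply: cvgeZr => //.
    by rewrite -fE; exact: cvg_nnsfun_approx.
  - by move=> n; apply: emeasurable_funM => //; exact/measurable_EFinP.
  - by move=> n x _; rewrite mule_ge0// lee_fin.
  - move=> x _ a b ab; rewrite lee_wpmul2r// lee_fin.
    exact/lefP/nd_nnsfun_approx.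
congr (limn _); apply/funext => n.
under eq_integral do rewrite fimfunE -fsumEFin//.
have gE x : ((g n x)%:E * (normal_pdf m s x)%:E =
    \sum_(r \in range (g n)) ((r * \1_(g n @^-1` [set r]) x)%:E *
      (normal_pdf m s x)%:E))%E.
  rewrite fimfunE -fsumEFin// ge0_mule_fsuml// => r.
  exact: nnfun_muleindic_ge0.
under [RHS]eq_integral do rewrite gE.
rewrite ge0_integral_fsum//; last 2 first.
  - by move=> r; exact/measurable_EFinP/measurableT_comp.
  - by move=> r x _; rewrite nnfun_muleindic_ge0.
rewrite ge0_integral_fsum//; last 2 first.
  - by move=> r; apply: emeasurable_funM => //; exact/measurable_EFinP/measurableT_comp.
  - by move=> r x _; rewrite mule_ge0// nnfun_muleindic_ge0.
apply: eq_fsbigr => r _.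
rewrite integralZl_indic_nnsfun// integral_indic// setIT.
have [r0|r0] := ltP r 0.
  rewrite preimage_nnfun0//.
  rewrite measure0 mule0 integral0_eq// => x _; by rewrite indic0 mulr0 mul0e.
under eq_integral do rewrite EFinM -muleA.
rewrite ge0_integralZl//; last 2 first.
  - apply: emeasurable_funM => //; exact/measurable_EFinP.
  - by move=> x _; rewrite mule_ge0// lee_fin.
congr (_ * _)%E; rewrite /normal_prob [LHS]integral_mkcond.
apply: eq_integral => x _.
by rewrite epatch_indic muleC.
Qed.

(** The integrand times the standard density is p^-1 times the density of standard deviation p^-1.
    Both p < 1 and p > 1 are used below. *)
Lemma integral_normal_expR (p : R) : 0 < p ->
  (\int[gauss]_x (expR ((1 - p ^+ 2) / 2 * x ^+ 2))%:E = p^-1%:E)%E.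
Proof.
move=> p0; have p0' : p != 0 by rewrite gt_eqF.
rewrite ge0_integral_normal_prob; last 2 first.
  - apply/measurable_EFinP; apply: measurableT_comp => //.
    by apply: measurable_funM => //; exact: measurable_funX.
  - by move=> x; rewrite lee_fin expR_ge0.
transitivity (\int[mu]_x (p^-1%:E * (normal_pdf 0 p^-1 x)%:E))%E.
  apply: eq_integral => x _; rewrite -!EFinM; congr (_%:E).
  rewrite !normal_pdfE ?oner_eq0 ?invr_eq0//.
  have -> : normal_peak p^-1 = p * normal_peak (1 : R).
    rewrite /normal_peak -!mulrnAr sqrtrM ?sqr_ge0// sqrtr_sqr.
    rewrite ger0_norm ?invr_ge0 ?ltW// expr1n mul1r invfM invrK.
    by [].
  rewrite -[p * _ * _]mulrA mulKf// /normal_fun mulrCA -expRD; congr (_ * expR _).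
  by rewrite subr0 expr1n; field; rewrite ?p0'.
rewrite ge0_integralZl//=; last 3 first.
  - by apply/measurable_EFinP; exact: measurable_normal_pdf.
  - by move=> x _; rewrite lee_fin normal_pdf_ge0.
  - by rewrite lee_fin invr_ge0 ltW.
by rewrite integral_normal_pdf mule1.
Qed.

Let gauss_setT : normal_prob (0 : R) 1 [set: measurableTypeR R] = 1%E.
Proof. exact: (probability_setT gauss). Qed.

Let measurable_exprn (k : nat) :
  measurable_fun [set: measurableTypeR R] (fun x : R => (x ^+ k)%:E).
Proof. by apply/measurable_EFinP; exact: measurable_funX. Qed.

Let integral_add1 (c : R) (f : R -> R) : 0 <= c ->
  measurable_fun [set: measurableTypeR R] f -> (forall x, 0 <= f x) ->
  (\int[gauss]_x (1 + c * f x)%:E = 1 + c%:E * \int[gauss]_x (f x)%:E)%E.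
Proof.
move=> c0 mf f0; under eq_integral do rewrite EFinD.
rewrite ge0_integralD//; last 2 first.
  - by move=> x _; rewrite lee_fin mulr_ge0.
  - by apply/measurable_EFinP; exact: measurable_funM.
rewrite integral_cst// mul1e; congr (_ + _)%E; first exact: gauss_setT.
under eq_integral do rewrite EFinM.
rewrite ge0_integralZl//; first exact/measurable_EFinP.
by move=> x _; rewrite lee_fin.
Qed.

(* Since [1 + u <= expR u] for both signs of [u], letting [p] tend to [1] in
   [integral_normal_expR] from either side pins down the second moment. *)
Lemma integral_normal_sqr : (\int[gauss]_x (x ^+ 2)%:E = 1)%E.
Proof.
set V := (\int[gauss]_x _)%E.
have msq : measurable_fun [set: measurableTypeR R] (fun x : R => x ^+ 2).
  exact: measurable_funX.
have mexp (c : R) : measurable_fun [set: measurableTypeR R]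
    (fun x : R => (expR (c * x ^+ 2))%:E).
  by apply/measurable_EFinP; apply: measurableT_comp => //; exact: measurable_funM.
have V0 : (0 <= V)%E by apply: integral_ge0 => x _; rewrite lee_fin sqr_ge0.
have up (p : R) : 0 < p < 1 -> (1 + ((1 - p ^+ 2) / 2)%:E * V <= p^-1%:E)%E.
  move=> /andP[p0 p1].
  have c0 : 0 <= (1 - p ^+ 2) / 2.
    by rewrite divr_ge0// subr_ge0 expr_le1// ltW.
  rewrite -integral_normal_expR// -integral_add1//; last by move=> x; exact: sqr_ge0.
  apply: ge0_le_integral => //.
  - by move=> x _; rewrite lee_fin addr_ge0// mulr_ge0// sqr_ge0.
  - by apply/measurable_EFinP; apply: measurable_funD => //; exact: measurable_funM.
  - by move=> x _; rewrite lee_fin expR_ge1Dx.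
(* The coefficient 1 - q^2 is negative, so its term is moved to the other side to keep all
   integrands nonnegative. *)
have dn (q : R) : 1 < q -> (1 <= q^-1%:E + ((q ^+ 2 - 1) / 2)%:E * V)%E.
  move=> q1; have q0 : 0 < q by apply: lt_trans q1.
  have c0 : 0 <= (q ^+ 2 - 1) / 2.
    by rewrite divr_ge0// subr_ge0 exprn_ege1// ltW.
  rewrite -integral_normal_expR// -ge0_integralZl//; last first.
    by move=> x _; rewrite lee_fin sqr_ge0.
  rewrite -ge0_integralD//; last 2 first.
    by move=> x _; rewrite -EFinM lee_fin mulr_ge0// sqr_ge0.
    by apply: emeasurable_funM => //; apply/measurable_EFinP.
  have -> : (1 = \int[gauss]_x (cst 1%E x) :> \bar R)%E.
    by rewrite integral_cst// mul1e; exact/esym/gauss_setT.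
  apply: ge0_le_integral => //.
  - by apply: emeasurable_funD => //; apply: emeasurable_funM => //; apply/measurable_EFinP.
  - move=> x _; rewrite -EFinM -EFinD lee_fin.
    have := expR_ge1Dx ((1 - q ^+ 2) / 2 * x ^+ 2); lra.
have Vfin : V \is a fin_num.
  rewrite ge0_fin_numE// ltNge leye_eq; apply/negP => /eqP Vy.
  have := up 2^-1; rewrite Vy invrK gt0_muley ?lte_fin; last lra.
  by rewrite addey// leNgt ltry => H; have : false by apply: H; lra.
rewrite -(fineK Vfin) in up dn *; set v := fine V in up dn *.
have {}up (p : R) : 0 < p < 1 -> 1 + (1 - p ^+ 2) / 2 * v <= p^-1.
  by move/up; rewrite -EFinM -EFinD lee_fin.
have {}dn (q : R) : 1 < q -> 1 <= q^-1 + (q ^+ 2 - 1) / 2 * v.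
  by move/dn; rewrite -EFinM -EFinD lee_fin.
have v13 : 3^-1 <= v by have := dn 2 ltac:(lra); lra.
clear - up dn v13.
have v0 : 0 < v by lra.
congr (_%:E); apply/eqP; rewrite eq_le; apply/andP; split; rewrite leNgt; apply/negP => v1.
  (* This point lies a third of the way from 1 to 1/v. Cancelling 1 - p in [up] leaves p (1 + p) v
     <= 2, which here reads (10 v - 1)(v - 1) <= 0, impossible for v > 1. *)
  pose p := (2 * v + 1) / (3 * v).
  have pE : p * (3 * v) = 2 * v + 1 by rewrite /p divfK//; lra.
  have p0 : 0 < p by rewrite divr_gt0//; lra.
  have p1 : p < 1 by rewrite /p ltr_pdivrMr; lra.
  have := up p ltac:(by rewrite p0 p1).
  rewrite -(ler_pM2r p0) mulVf ?gt_eqF// => h.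
  have h2 : (1 - p) * (p * (1 + p) * v - 2) <= 0 by lra.
  have h3 : p * (1 + p) * v <= 2.
    by rewrite -subr_le0 -(@pmulr_rle0 _ (1 - p))//; lra.
  have h4 : (p * (3 * v)) * (3 * v + p * (3 * v)) <= 18 * v.
    have : (p * (1 + p) * v) * v <= 2 * v by rewrite ler_pM2r.
    lra.
  by rewrite pE in h4; nra.
(* The mirror argument for v < 1 yields (10 v - 1)(v - 1) >= 0, which [v13] excludes since it makes
   10 v - 1 positive. *)
pose q := (2 * v + 1) / (3 * v).
have qE : q * (3 * v) = 2 * v + 1 by rewrite /q divfK//; lra.
have q1 : 1 < q by rewrite /q ltr_pdivlMr; lra.
have q0 : 0 < q by lra.
have := dn q q1; rewrite -(ler_pM2r q0) mulrDl mulVf ?gt_eqF// => h.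
have h2 : 0 <= (q - 1) * (q * (1 + q) * v - 2) by lra.
have h3 : 2 <= q * (1 + q) * v.
  by rewrite -subr_ge0 -(@pmulr_rge0 _ (q - 1))//; lra.
have h4 : 18 * v <= (q * (3 * v)) * (3 * v + q * (3 * v)).
  have : 2 * v <= (q * (1 + q) * v) * v by rewrite ler_pM2r.
  lra.
by rewrite qE in h4; nra.
Qed.

(** The exact value is 3. The cruder 5 suffices and follows from a single exponential moment. *)
Lemma integral_normal_pow4 : (\int[gauss]_x (x ^+ 4)%:E <= 5%:E)%E.
Proof.
set W := (\int[gauss]_x _)%E.
have W0 : (0 <= W)%E by apply: integral_ge0 => x _; rewrite lee_fin exprn_even_ge0.
have mX k : measurable_fun [set: measurableTypeR R] (fun x : R => x ^+ k).
  exact: measurable_funX.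
(* [(1 + u / 4) ^ 4 <= expR u] at [u = c x^2], where [c = (1 - p^2) / 2], [p = 9 / 10]. *)
pose c : R := 19 / 200.
have cE : (1 - (9 / 10) ^+ 2) / 2 = c by rewrite /c; field.
have h : ((1 + c)%:E + (3 / 8 * c ^+ 2)%:E * W <= (10 / 9)%:E)%E.
  have -> : (10 / 9 = (9 / 10)^-1 :> R) by field.
  rewrite -integral_normal_expR; last lra.
  have -> : ((1 + c)%:E = \int[gauss]_x (1 + c * x ^+ 2)%:E)%E.
    rewrite integral_add1 ?integral_normal_sqr ?mule1//; last by move=> x; exact: sqr_ge0.
    by rewrite /c; lra.
  rewrite cE -ge0_integralZl//; last 2 first.
    by move=> x _; rewrite lee_fin exprn_even_ge0.
    by rewrite lee_fin /c; lra.
  have c0 : 0 <= c by rewrite /c; lra.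
  have k0 (x : R) : 0 <= 3 / 8 * c ^+ 2 * x ^+ 4.
    by rewrite mulr_ge0 ?exprn_even_ge0// /c; lra.
  have q0 (x : R) : 0 <= c * x ^+ 2 by rewrite mulr_ge0// sqr_ge0.
  rewrite -ge0_integralD//; last 4 first.
    by move=> x _; rewrite lee_fin addr_ge0.
    by apply/measurable_EFinP; apply: measurable_funD => //; exact: measurable_funM.
    by move=> x _; rewrite -EFinM lee_fin; exact: k0.
    by apply: emeasurable_funM.
  apply: ge0_le_integral => //.
  - move=> x _; rewrite -EFinM -EFinD lee_fin; apply: addr_ge0; last exact: k0.
    exact: addr_ge0.
  - apply: emeasurable_funD; last exact: emeasurable_funM.
    by apply/measurable_EFinP; apply: measurable_funD => //; exact: measurable_funM.
  - by apply/measurable_EFinP; apply: measurableT_comp => //; exact: measurable_funM.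
  - move=> x _; rewrite -EFinM -EFinD lee_fin.
    have -> : x ^+ 4 = (x ^+ 2) ^+ 2 by ring.
    set u := x ^+ 2; have u0 : 0 <= u by exact: sqr_ge0.
    have -> : c * u = 4%:R * (c * u / 4) by field.
    rewrite expRM_natl; have y0 : 0 <= c * u / 4 by rewrite divr_ge0// mulr_ge0.
    apply: (@le_trans _ _ ((1 + c * u / 4) ^+ 4)); last first.
      by rewrite ler_pXn2r// ?nnegrE ?addr_ge0 ?expR_ge0// expR_ge1Dx.
    set y := c * u / 4 in y0 *; have yE : y = c * u / 4 by []. clearbody y.
    have -> : 3 / 8 * c ^+ 2 * u ^+ 2 = 6 * y ^+ 2 by rewrite yE; field.
    have -> : (1 + y) ^+ 4 = 1 + 4 * y + 6 * y ^+ 2 + (4 * y ^+ 3 + y ^+ 4) by ring.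
    have : 0 <= 4 * y ^+ 3 + y ^+ 4 by rewrite addr_ge0 ?mulr_ge0 ?exprn_ge0.
    lra.
have Wfin : W \is a fin_num.
  rewrite ge0_fin_numE// ltNge leye_eq; apply/negP => /eqP Wy.
  move: h; rewrite Wy gt0_muley ?lte_fin; last by rewrite /c; lra.
  by rewrite addey// leNgt ltry.
rewrite -(fineK Wfin) in h *; move: h.
by rewrite -EFinM -EFinD !lee_fin /c; lra.
Qed.

End gaussian_moments.

(** * Moments of quadratic polynomials in one coordinate *)

Section coordinate_moments.
Context {R : realType}.
Local Notation mu := lebesgue_measure.
Local Notation law := (probability (measurableTypeR R) R).
Local Notation gauss := (normal_prob 0 1 : law).

(* Moment bounds for a law of variance [v], [v] being [0] or [1], in the form in
   which they tensorize: the quadratic polynomial is [g |-> |r + g c|^2] for two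
   vectors [r] and [c]. *)
Definition quadratic_moments (P : law) (v : R) := forall a b d : R,
  0 <= a -> 0 <= d -> b ^+ 2 <= a * d ->
  (\int[P]_g (a + 2 * b * g + d * g ^+ 2)%:E = (a + v * d)%:E)%E /\
  (\int[P]_g ((a + 2 * b * g + d * g ^+ 2) ^+ 2)%:E <=
    (a ^+ 2 + 6 * v * (a * d) + 5 * v * d ^+ 2)%:E)%E.

Lemma quadratic_ge0 (a b d g : R) : 0 <= a -> 0 <= d -> b ^+ 2 <= a * d ->
  0 <= a + 2 * b * g + d * g ^+ 2.
Proof.
move=> a0 d0 bad; have [dp|] := ltP 0 d; last first.
  move=> d0'; have dE : d = 0 by apply/eqP; rewrite eq_le d0 d0'.
  have : b ^+ 2 <= 0 by rewrite dE mulr0 in bad.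
  rewrite dE real_exprn_even_le0 ?num_real//= => /eqP ->.
  by rewrite mulr0 !mul0r !addr0.
rewrite -(pmulr_rge0 _ dp).
have -> : d * (a + 2 * b * g + d * g ^+ 2) = (d * g + b) ^+ 2 + (a * d - b ^+ 2) by ring.
by rewrite addr_ge0 ?sqr_ge0// subr_ge0.
Qed.

Lemma measurable_quadratic (a b d : R) : measurable_fun [set: measurableTypeR R]
  (fun g : R => a + 2 * b * g + d * g ^+ 2).
Proof.
apply: measurable_funD; first by apply: measurable_funD => //; exact: measurable_funM.
by apply: measurable_funM => //; exact: measurable_funX.
Qed.

Lemma quadratic_moments_dirac : quadratic_moments (\d_(0 : measurableTypeR R) : law) 0.
Proof.
move=> a b d a0 d0 bad; have mq := measurable_quadratic a b d; split.
  rewrite integral_dirac//; last exact/measurable_EFinP.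
  by rewrite diracT mul1e expr0n/= !mulr0 mul0r !addr0.
rewrite integral_dirac//; last by apply/measurable_EFinP; exact: measurable_funX.
by rewrite diracT mul1e expr0n/= !mulr0 !mul0r !addr0.
Qed.

Lemma integral_normal_opp (f : measurableTypeR R -> \bar R) :
  measurable_fun [set: measurableTypeR R] f -> (forall x, 0 <= f x)%E ->
  (\int[gauss]_x f (- x)%R = \int[gauss]_x f x)%E.
Proof.
move=> mf f0.
have mopp : measurable_fun [set: measurableTypeR R]
  (-%R : measurableTypeR R -> measurableTypeR R) by exact: measurable_funN.
have mfopp : measurable_fun [set: measurableTypeR R] (fun x => f (- x)%R).
  exact: (measurableT_comp mf mopp).
rewrite !ge0_integral_normal_prob//.
pose h (x : measurableTypeR R) := (f x * (normal_pdf 0 1 x)%:E)%E.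
have mh : measurable_fun [set: measurableTypeR R] h.
  apply: emeasurable_funM => //; apply/measurable_EFinP; exact: measurable_normal_pdf.
have h0 x : (0 <= h x)%E by rewrite mule_ge0// ?lee_fin normal_pdf_ge0.
transitivity (\int[mu]_x (h \o (-%R : measurableTypeR R -> measurableTypeR R)) x)%E.
  apply: eq_integral => x _; rewrite /h/=; congr (_ * _%:E)%E.
  rewrite !normal_pdfE ?oner_eq0//; congr (_ * _).
  by rewrite /normal_fun !subr0 sqrrN.
rewrite -[LHS](@ge0_integral_pushforward _ _ _ _ R _ mopp mu setT h)//.
by apply: eq_measure_integral => A mA _; exact: lebesgue_measureN.
Qed.

(** By symmetry of the law [f] can be replaced by its even part. Odd moments, whose integrands
    change sign, thus never have to be integrated. *)
Lemma integral_normal_even_part (f h : R -> R) :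
  measurable_fun [set: measurableTypeR R] f -> (forall x, 0 <= f x) ->
  (forall x, f x + f (- x) = 2 * h x) ->
  (\int[gauss]_x (f x)%:E = \int[gauss]_x (h x)%:E)%E.
Proof.
move=> mf f0 fh.
have h0 x : 0 <= h x by have := fh x; have := f0 x; have := f0 (- x); lra.
have mfopp : measurable_fun [set: measurableTypeR R] (fun x => f (- x)).
  by apply: (@measurableT_comp _ _ _ _ _ _ f) => //; exact: measurable_funN.
have mh : measurable_fun [set: measurableTypeR R] h.
  have -> : h = fun x => 2^-1 * (f x + f (- x)) by apply/funext => x; rewrite fh mulKf.
  by apply: measurable_funM => //; exact: measurable_funD.
suff E2 : (2%:E * \int[gauss]_x (f x)%:E = 2%:E * \int[gauss]_x (h x)%:E)%E.
  have inj2 (x y : \bar R) : (2%:E * x = 2%:E * y -> x = y)%E.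
    by move=> /eqP; rewrite eq_le !lee_pmul2l// -eq_le => /eqP.
  exact: inj2.
rewrite -[RHS]ge0_integralZl//; last first.
- by move=> x _; rewrite lee_fin.
- exact/measurable_EFinP.
under [RHS]eq_integral do rewrite -EFinM -fh EFinD.
rewrite ge0_integralD//; last 4 first.
  by move=> x _; rewrite lee_fin.
  exact/measurable_EFinP.
  by move=> x _; rewrite lee_fin.
  exact/measurable_EFinP.
have := @integral_normal_opp (EFin \o f).
move=> /= ->; last by move=> x; rewrite lee_fin.
  by rewrite -mule2n mule_natl.
exact/measurable_EFinP.
Qed.

(** The even part of the squared polynomial is a^2 + (4 b^2 + 2 a d) g^2 + d^2 g^4. The bound b^2 <=
    a d turns the middle coefficient into 6 a d, and the fourth moment gives the 5. *)
Lemma quadratic_moments_normal : quadratic_moments gauss 1.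
Proof.
move=> a b d a0 d0 bad; have mq := measurable_quadratic a b d.
have q0 g := quadratic_ge0 g a0 d0 bad.
have m2 : measurable_fun [set: measurableTypeR R] (fun g : R => (g ^+ 2)%:E).
  by apply/measurable_EFinP; exact: measurable_funX.
have m4 : measurable_fun [set: measurableTypeR R] (fun g : R => (g ^+ 4)%:E).
  by apply/measurable_EFinP; exact: measurable_funX.
have p2 (g : R) : (0 <= (g ^+ 2)%:E)%E by rewrite lee_fin sqr_ge0.
have p4 (g : R) : (0 <= (g ^+ 4)%:E)%E by rewrite lee_fin exprn_even_ge0.
have cst_int (c : R) : (\int[gauss]_x (cst c%:E x) = c%:E)%E.
  rewrite integral_cst// -[RHS]mule1; congr (_ * _)%E.
  exact: (probability_setT gauss).
split.
  have := @integral_normal_even_part _ (fun g => a + d * g ^+ 2) mq q0.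
  move=> /(_ (fun g => ltac:(ring))) E.
  rewrite E; under eq_integral do rewrite EFinD EFinM.
  rewrite ge0_integralD//; last 2 first.
    by move=> x _; rewrite mule_ge0// ?lee_fin.
    exact: emeasurable_funM.
  rewrite cst_int ge0_integralZl//.
  by rewrite integral_normal_sqr mule1 mul1r -EFinD.
have mq2 : measurable_fun [set: measurableTypeR R]
    (fun g : R => (a + 2 * b * g + d * g ^+ 2) ^+ 2) by exact: measurable_funX.
have := @integral_normal_even_part _
  (fun g => a ^+ 2 + (4 * b ^+ 2 + 2 * a * d) * g ^+ 2 + d ^+ 2 * g ^+ 4) mq2
  (fun g => sqr_ge0 _).
move=> /(_ (fun g => ltac:(ring))) E.
have k0 : 0 <= 4 * b ^+ 2 + 2 * a * d by have := sqr_ge0 b; have := mulr_ge0 a0 d0; lra.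
rewrite E (eq_integral (fun g : measurableTypeR R => (a ^+ 2)%:E +
    (4 * b ^+ 2 + 2 * a * d)%:E * ((g : R) ^+ 2)%:E +
    (d ^+ 2)%:E * ((g : R) ^+ 4)%:E)%E);
  last by move=> x _; rewrite -!EFinM -!EFinD.
have d2 : (0 <= (d ^+ 2)%:E)%E by rewrite lee_fin sqr_ge0.
have a2 : (0 <= (a ^+ 2)%:E)%E by rewrite lee_fin sqr_ge0.
have e0 : (0 <= (4 * b ^+ 2 + 2 * a * d)%:E)%E by rewrite lee_fin.
rewrite ge0_integralD//; last 4 first.
- by move=> x _; rewrite adde_ge0 ?mule_ge0.
- by apply: emeasurable_funD => //; exact: emeasurable_funM.
- by move=> x _; rewrite mule_ge0.
- exact: emeasurable_funM.
rewrite ge0_integralD//; last 2 first.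
- by move=> x _; rewrite mule_ge0.
- exact: emeasurable_funM.
rewrite cst_int !ge0_integralZl//.
rewrite integral_normal_sqr mule1.
apply: (@le_trans _ _ ((a ^+ 2)%:E + (4 * b ^+ 2 + 2 * a * d)%:E + (d ^+ 2)%:E * 5%:E)%E).
  by apply: leeD => //; apply: lee_wpmul2l; [rewrite lee_fin sqr_ge0|exact: integral_normal_pow4].
by rewrite -EFinM -!EFinD lee_fin; lra.
Qed.

End coordinate_moments.

(** * Independent coordinates *)

Section product_moments.
Context {R : realType}.
Local Notation law := (probability (measurableTypeR R) R).
Local Notation MR := (measurableTypeR R).

(** This is |r + sum_i x_i c_i|^2 for vectors r and c_i of length k. The offset [r] lets an
    induction over the coordinates absorb those already fixed. *)
Definition affine_sqr_norm n k (r : 'I_k -> R) (c : 'I_n -> 'I_k -> R)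
    (x : n.-tuple MR) : R :=
  \sum_l (r l + \sum_i tnth x i * c i l) ^+ 2.

Lemma affine_sqr_norm_ge0 n k r c x : 0 <= @affine_sqr_norm n k r c x.
Proof. by apply: sumr_ge0 => l _; exact: sqr_ge0. Qed.

Lemma measurable_affine_sqr_norm n k r c :
  measurable_fun [set: n.-tuple MR] (@affine_sqr_norm n k r c).
Proof.
apply: measurable_sum => l; apply: measurable_funX; apply: measurable_funD => //.
by apply: measurable_sum => i; apply: measurable_funM => //; exact: measurable_tnth.
Qed.

Lemma sum_mul_sqr_le k (r c : 'I_k -> R) :
  (\sum_l r l * c l) ^+ 2 <= (\sum_l r l ^+ 2) * (\sum_l c l ^+ 2).
Proof.
have : 0 <= \sum_l \sum_j (r l * c j - r j * c l) ^+ 2.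
  by apply: sumr_ge0 => l _; apply: sumr_ge0 => j _; exact: sqr_ge0.
have -> : \sum_l \sum_j (r l * c j - r j * c l) ^+ 2 =
    2 * ((\sum_l r l ^+ 2) * (\sum_l c l ^+ 2)) - 2 * (\sum_l r l * c l) ^+ 2.
  transitivity (\sum_l (r l ^+ 2 * (\sum_j c j ^+ 2) +
      c l ^+ 2 * (\sum_j r j ^+ 2) - 2 * (r l * c l * (\sum_j r j * c j)))).
    apply: eq_bigr => l _; rewrite !mulr_sumr -big_split/= -sumrB.
    by apply: eq_bigr => j _; ring.
  by rewrite sumrB big_split/= -!mulr_sumr -!mulr_suml; ring.
lra.
Qed.

Lemma affine_sqr_norm_cons n k r c (g : MR) (x : n.-tuple MR) :
  @affine_sqr_norm n.+1 k r c (tuple_cons (g, x)) =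
  affine_sqr_norm (fun l => r l + g * c ord0 l) (fun i => c (lift ord0 i)) x.
Proof.
apply: eq_bigr => l _; rewrite big_ord_recl /tuple_cons /= tnth0 addrA.
by congr ((_ + _) ^+ 2); apply: eq_bigr => i _; rewrite tnthS.
Qed.

(** Induction on n: once the first coordinate g is fixed, the rest is the same problem with offset r
    + g c_0, whose squared norm is a quadratic polynomial in g covered by [quadratic_moments]. The
    form a^2 + 6 a s + 5 s^2 reproduces itself, since the cross term needs 6 and 10 is available. *)
Lemma product_law_moments n k (P : 'I_n -> law) (v : 'I_n -> R)
    (r : 'I_k -> R) (c : 'I_n -> 'I_k -> R) :
  (forall i, v i = 0 \/ v i = 1) ->
  (forall i, quadratic_moments (P i) (v i)) ->
  let a := \sum_l r l ^+ 2 in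
  let s := \sum_i v i * \sum_l c i l ^+ 2 in
  (\int[product_law P]_x (affine_sqr_norm r c x)%:E = (a + s)%:E)%E /\
  (\int[product_law P]_x (affine_sqr_norm r c x ^+ 2)%:E <=
    (a ^+ 2 + 6 * (a * s) + 5 * s ^+ 2)%:E)%E.
Proof.
elim: n P v r c => [|n IH] P v r c v01 Pv a s.
  have s0 : s = 0 by rewrite /s big_ord0.
  have E : affine_sqr_norm r c [tuple] = a.
    by apply: eq_bigr => l _; rewrite big_ord0 addr0.
  have mN := measurable_affine_sqr_norm r c.
  rewrite /product_law s0; split.
    rewrite integral_dirac//; last exact/measurable_EFinP.
    by rewrite diracT mul1e E addr0.
  rewrite integral_dirac//; last by apply/measurable_EFinP; exact: measurable_funX.
  by rewrite diracT mul1e E mulr0 expr0n/= !mulr0 !addr0.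
pose P' i := P (lift ord0 i); pose v' i := v (lift ord0 i).
pose c' i := c (lift ord0 i); pose r' (g : R) l := r l + g * c ord0 l.
pose b := \sum_l r l * c ord0 l; pose d := \sum_l c ord0 l ^+ 2.
pose s' := \sum_i v' i * \sum_l c' i l ^+ 2.
have sE : s = v ord0 * d + s' by rewrite /s big_ord_recl.
have v0 i : 0 <= v i by case: (v01 i) => ->.
have a0 : 0 <= a by apply: sumr_ge0 => l _; exact: sqr_ge0.
have d0 : 0 <= d by apply: sumr_ge0 => l _; exact: sqr_ge0.
have s'0 : 0 <= s'.
  apply: sumr_ge0 => i _; apply: mulr_ge0; first exact: v0.
  by apply: sumr_ge0 => l _; exact: sqr_ge0.
have bad : b ^+ 2 <= a * d by exact: sum_mul_sqr_le.
have bad' : b ^+ 2 <= (a + s') * d.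
  by apply: le_trans bad _; rewrite ler_wpM2r// lerDl.
have as0 : 0 <= a + s' by rewrite addr_ge0.
have aE g : \sum_l r' g l ^+ 2 = a + 2 * b * g + d * g ^+ 2.
  rewrite /a /b /d mulr_sumr !mulr_suml -!big_split/=.
  by apply: eq_bigr => l _; rewrite /r'; ring.
(* The conditional mean given g is the quadratic polynomial with constant term a + s'. *)
have [q1 _] := Pv ord0 (a + s') b d as0 d0 bad'.
have [q1' q2] := Pv ord0 a b d a0 d0 bad.
have IH' g := IH P' v' (r' g) c' (fun i => v01 _) (fun i => Pv _).
have mN := measurable_affine_sqr_norm r c.
have mcons := @measurable_tuple_cons _ MR n.
have qm := measurable_quadratic a b d.
have qm2 : measurable_fun [set: MR] (fun g : R => (a + 2 * b * g + d * g ^+ 2) ^+ 2).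
  exact: measurable_funX.
have qq g := quadratic_ge0 g a0 d0 bad.
split.
  rewrite /= ge0_integral_distribution//; last 2 first.
    exact/measurable_EFinP.
    by move=> x; rewrite lee_fin affine_sqr_norm_ge0.
  rewrite fubini_tonelli1/=; last 2 first.
    by apply/measurable_EFinP; exact: (measurableT_comp mN mcons).
    by move=> x; rewrite lee_fin affine_sqr_norm_ge0.
  have -> : a + s = a + s' + v ord0 * d by rewrite sE; ring.
  rewrite -q1; apply: eq_integral => g _.
  rewrite /fubini_F /=; under eq_integral do rewrite affine_sqr_norm_cons.
  by have [-> _] := IH' g; rewrite aE; congr (_%:E); rewrite /s'; ring.
rewrite /= ge0_integral_distribution//; last 2 first.
  by apply/measurable_EFinP; exact: measurable_funX.
  by move=> x; rewrite lee_fin sqr_ge0.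
have mN2 : measurable_fun [set: MR * n.-tuple MR]
    (fun x => (affine_sqr_norm r c (tuple_cons x) ^+ 2)%:E).
  by apply/measurable_EFinP; apply: measurable_funX; exact: (measurableT_comp mN mcons).
rewrite fubini_tonelli1//=; last by move=> x; rewrite lee_fin sqr_ge0.
pose q (g : R) := a + 2 * b * g + d * g ^+ 2.
apply: (@le_trans _ _ (\int[P ord0]_g ((q g ^+ 2)%:E +
    ((6 * s')%:E * (q g)%:E + (5 * s' ^+ 2)%:E)))%E).
  apply: ge0_le_integral => //.
  - by move=> g _; apply: integral_ge0 => x _; rewrite lee_fin sqr_ge0.
  - apply: (measurable_fun_fubini_tonelli_F _ mN2) => x.
    by rewrite lee_fin sqr_ge0.
  - apply: emeasurable_funD; first exact/measurable_EFinP.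
    apply: emeasurable_funD => //; apply: emeasurable_funM => //.
    exact/measurable_EFinP.
  - move=> g _; rewrite /fubini_F /=.
    under eq_integral do rewrite affine_sqr_norm_cons.
    have [_] := IH' g; rewrite aE -/(q g) -/s' => /le_trans; apply.
    by rewrite -EFinM -!EFinD lee_fin; lra.
have s6 : (0 <= (6 * s')%:E)%E by rewrite lee_fin mulr_ge0.
have s5 : (0 <= (5 * s' ^+ 2)%:E)%E by rewrite lee_fin mulr_ge0 ?sqr_ge0.
have qe g : (0 <= (q g)%:E)%E by rewrite lee_fin; exact: qq.
have mq : measurable_fun [set: MR] (fun g : R => (q g)%:E) by exact/measurable_EFinP.
rewrite ge0_integralD//; last 4 first.
- by move=> g _; rewrite lee_fin sqr_ge0.
- exact/measurable_EFinP.
- by move=> g _; rewrite adde_ge0// mule_ge0.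
- by apply: emeasurable_funD => //; exact: emeasurable_funM.
rewrite ge0_integralD//; last 2 first.
- by move=> g _; rewrite mule_ge0.
- exact: emeasurable_funM.
have ci : (\int[P ord0]_g (cst (5 * s' ^+ 2)%:E g) = (5 * s' ^+ 2)%:E)%E.
  rewrite integral_cst// -[RHS]mule1; congr (_ * _)%E.
  exact: (probability_setT (P ord0)).
rewrite ge0_integralZl// q1' ci -EFinM -EFinD.
apply: le_trans (leeD q2 (lexx _)) _; rewrite -EFinD lee_fin sE.
have vv : v ord0 * v ord0 = v ord0 by case: (v01 ord0) => ->; rewrite ?mulr0 ?mulr1.
have -> : (v ord0 * d + s') ^+ 2 =
  v ord0 * v ord0 * d ^+ 2 + 2 * (v ord0 * d * s') + s' ^+ 2 by ring.
rewrite vv.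
have : 0 <= v ord0 * d * s' by rewrite !mulr_ge0.
lra.
Qed.

End product_moments.

(** * Second and fourth moments of a bilinear form in Gaussian vectors *)

Section bilinear_forms.
Context {R : realType}.
Local Notation MR := (measurableTypeR R).
Variable n : nat.
Implicit Types (S T : {set 'I_n}) (M : 'I_n -> 'I_n -> R) (x y : n.-tuple MR).

Definition gauss_on S : probability (n.-tuple MR) R := product_law (coord_law 1 S).

Lemma coord_law_moments S i :
  quadratic_moments (coord_law 1 S i) ((i \in S)%:R : R).
Proof.
rewrite /coord_law sqrtr1; case: (i \in S).
  exact: quadratic_moments_normal.
exact: quadratic_moments_dirac.
Qed.

Lemma gauss_on_moments S k (c : 'I_n -> 'I_k -> R) :
  let s := \sum_(i in S) \sum_l c i l ^+ 2 in
  (\int[gauss_on S]_x (affine_sqr_norm (fun=> 0) c x)%:E = s%:E)%E /\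
  (\int[gauss_on S]_x (affine_sqr_norm (fun=> 0) c x ^+ 2)%:E <=
    (5 * s ^+ 2)%:E)%E.
Proof.
move=> s; have v01 i : (i \in S)%:R = 0 :> R \/ (i \in S)%:R = 1 :> R.
  by case: (i \in S); [right|left].
have := product_law_moments (fun=> 0) c v01 (coord_law_moments S) => /=.
have z : \sum_(l < k) 0 ^+ 2 = 0 :> R by rewrite big1// => l _; rewrite expr0n.
rewrite z expr0n mul0r mulr0 !add0r.
by rewrite -sum_setE.
Qed.

Definition bilin M x y : R := \sum_i \sum_j tnth x i * tnth y j * M i j.

Definition sqsum x : R := \sum_i tnth x i ^+ 2.

Definition block_sqnorm M S T : R := \sum_(i in S) \sum_(j in T) M i j ^+ 2.

Lemma measurable_bilin M :
  measurable_fun [set: n.-tuple MR * n.-tuple MR] (fun p => bilin M p.1 p.2).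
Proof.
apply: measurable_sum => i; apply: measurable_sum => j.
apply: measurable_funM => //; apply: measurable_funM.
  by apply: (measurableT_comp (measurable_tnth i)).
by apply: (measurableT_comp (measurable_tnth j)).
Qed.

Lemma measurable_sqsum : measurable_fun [set: n.-tuple MR] sqsum.
Proof.
by apply: measurable_sum => i; apply: measurable_funX; exact: measurable_tnth.
Qed.

Lemma sqsum_ge0 x : 0 <= sqsum x.
Proof. by apply: sumr_ge0 => i _; exact: sqr_ge0. Qed.

Lemma bilin_sqrE M x y :
  bilin M x y ^+ 2 =
  affine_sqr_norm (fun _ : 'I_1 => 0) (fun i _ => \sum_j tnth y j * M i j) x.
Proof.
rewrite /affine_sqr_norm big_ord1 add0r; congr (_ ^+ 2).
apply: eq_bigr => i _; rewrite mulr_sumr; apply: eq_bigr => j _.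
by rewrite mulrA.
Qed.

(** The left side is the second moment over x of the form with y fixed. Rewriting it as a squared
    norm that is linear in y lets the same moment lemma be used a second time. *)
Lemma sum_rows_sqrE M S y :
  \sum_(i in S) (\sum_j tnth y j * M i j) ^+ 2 =
  affine_sqr_norm (fun _ : 'I_n => 0)
    (fun j i => if i \in S then M i j else 0) y.
Proof.
rewrite big_mkcond; apply: eq_bigr => i _; rewrite add0r.
case: ifP => // _; rewrite big1 ?expr0n// => j _; exact: mulr0.
Qed.

Lemma block_sqnormE M S T :
  \sum_(j in T) \sum_i (if i \in S then M i j else 0) ^+ 2 = block_sqnorm M S T.
Proof.
rewrite /block_sqnorm [RHS]exchange_big/=; apply: eq_bigr => j _.
rewrite [RHS]big_mkcond/=; apply: eq_bigr => i _.
by case: ifP; rewrite ?expr0n.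
Qed.

Let bilin_x M k : measurable_fun [set: n.-tuple MR * n.-tuple MR]
  (fun p => (bilin M p.1 p.2 ^+ k)%:E).
Proof. by apply/measurable_EFinP; apply: measurable_funX; exact: measurable_bilin. Qed.

Lemma integral_bilin_sqr M S T :
  (\int[gauss_on S \x gauss_on T]_p (bilin M p.1 p.2 ^+ 2)%:E =
   (block_sqnorm M S T)%:E)%E.
Proof.
rewrite fubini_tonelli2//=; last by move=> p; rewrite lee_fin sqr_ge0.
rewrite -block_sqnormE.
have [<- _] := gauss_on_moments T (fun j i => if i \in S then M i j else 0).
apply: eq_integral => y _; rewrite /fubini_G /=.
under eq_integral do rewrite bilin_sqrE.
have [-> _] := gauss_on_moments S (fun i (_ : 'I_1) => \sum_j tnth y j * M i j).
rewrite -sum_rows_sqrE; congr (_%:E); apply: eq_bigr => i _.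
by rewrite big_ord1.
Qed.

(** For fixed y the fourth moment in x is at most 5 N(y)^2, and the second moment of N in y is at
    most 5 |M_ST|^4, whence 25 = 5 * 5. *)
Lemma integral_bilin_pow4 M S T :
  (\int[gauss_on S \x gauss_on T]_p (bilin M p.1 p.2 ^+ 4)%:E <=
   (25 * block_sqnorm M S T ^+ 2)%:E)%E.
Proof.
rewrite fubini_tonelli2//=; last by move=> p; rewrite lee_fin exprn_even_ge0.
pose N y := affine_sqr_norm (fun _ : 'I_n => 0)
    (fun j i => if i \in S then M i j else 0) y.
have mN : measurable_fun [set: n.-tuple MR] (fun y => (N y ^+ 2)%:E).
  apply/measurable_EFinP; apply: measurable_funX.
  exact: measurable_affine_sqr_norm.
apply: (@le_trans _ _ (\int[gauss_on T]_y (5%:E * (N y ^+ 2)%:E))%E).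
  apply: ge0_le_integral => //.
  - by move=> y _; apply: integral_ge0 => x _; rewrite lee_fin exprn_even_ge0.
  - apply: (measurable_fun_fubini_tonelli_G _ (bilin_x M 4)) => p.
    by rewrite lee_fin exprn_even_ge0.
  - exact: emeasurable_funM.
  - move=> y _; rewrite /fubini_G /=.
    have := gauss_on_moments S (fun i (_ : 'I_1) => \sum_j tnth y j * M i j).
    move=> -[_]; under [X in (_ <= (5 * X ^+ 2)%:E)%E -> _]eq_bigr do rewrite big_ord1.
    rewrite sum_rows_sqrE -/(N y) -EFinM; apply: le_trans.
    rewrite le_eqVlt; apply/orP; left; apply/eqP.
    by apply: eq_integral => x _; rewrite -bilin_sqrE -exprM.
rewrite ge0_integralZl//; last by move=> y _; rewrite lee_fin sqr_ge0.
have [_] := gauss_on_moments T (fun j i => if i \in S then M i j else 0).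
rewrite block_sqnormE => h.
apply: le_trans (lee_wpmul2l _ h) _ => //.
by rewrite -EFinM lee_fin; lra.
Qed.

Lemma integral_sqsum S : (\int[gauss_on S]_x (sqsum x)%:E = (#|S|%:R)%:E :> \bar R)%E.
Proof.
have [+ _] := gauss_on_moments S (fun i l : 'I_n => (i == l)%:R : R).
have -> : \sum_(i in S) \sum_(l < n) ((i == l)%:R : R) ^+ 2 = #|S|%:R.
  rewrite -sum1_card natr_sum; apply: eq_bigr => i _.
  rewrite (bigD1 i)//= eqxx expr1n big1 ?addr0// => l li.
  by rewrite eq_sym (negbTE li) expr0n.
move=> <-; apply: eq_integral => x _; congr (_%:E); apply: eq_bigr => l _.
rewrite add0r (bigD1 l)//= eqxx mulr1 big1 ?addr0// => i il.
by rewrite (negbTE il) mulr0.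
Qed.

Lemma integral_sqsumM S T :
  (\int[gauss_on S \x gauss_on T]_p (sqsum p.1 * sqsum p.2)%:E =
   (#|S|%:R * #|T|%:R)%:E :> \bar R)%E.
Proof.
have ms := measurable_sqsum.
rewrite fubini_tonelli1//=; last 2 first.
  by apply/measurable_EFinP; apply: measurable_funM;
    [exact: (measurableT_comp ms)|exact: (measurableT_comp ms)].
  by move=> p; rewrite lee_fin mulr_ge0 ?sqsum_ge0.
under eq_integral => x _.
  rewrite /fubini_F /=; under eq_integral do rewrite EFinM.
  rewrite ge0_integralZl//; last 3 first.
    exact/measurable_EFinP.
    by move=> y _; rewrite lee_fin sqsum_ge0.
    by rewrite lee_fin sqsum_ge0.
  rewrite integral_sqsum muleC.
  over.
rewrite ge0_integralZl//; last 2 first.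
  exact/measurable_EFinP.
  by move=> y _; rewrite lee_fin sqsum_ge0.
by rewrite integral_sqsum -EFinM mulrC.
Qed.

End bilinear_forms.

(** * Tail bound for a fixed pair of supports *)

Section tail.
Context {R : realType}.
Local Notation MR := (measurableTypeR R).
Variable n : nat.
Implicit Types (S T : {set 'I_n}) (M : 'I_n -> 'I_n -> R).

(** The squared form of |x^T M y| <= g |x| |y| for g >= 0, which is polynomial in the
    coordinates. *)
Definition small_bilin M (g : R) : set (n.-tuple MR * n.-tuple MR) :=
  [set p | bilin M p.1 p.2 ^+ 2 <= g ^+ 2 * (sqsum p.1 * sqsum p.2)].

Lemma measurable_small_bilin M g : measurable (small_bilin M g).
Proof.
have ms := @measurable_sqsum R n.
have mf : measurable_fun [set: n.-tuple MR * n.-tuple MR]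
    (fun p => g ^+ 2 * (sqsum p.1 * sqsum p.2) - bilin M p.1 p.2 ^+ 2 : R).
  apply: measurable_funB; last by apply: measurable_funX; exact: measurable_bilin.
  by apply: measurable_funM => //; apply: measurable_funM;
    [exact: (measurableT_comp ms)|exact: (measurableT_comp ms)].
rewrite (_ : small_bilin M g =
    (fun p => g ^+ 2 * (sqsum p.1 * sqsum p.2) - bilin M p.1 p.2 ^+ 2 : R)
      @^-1` `[0, +oo[).
  by rewrite -[X in measurable X]setTI; exact: mf.
by apply/seteqP; split => p /=; rewrite in_itv/= andbT subr_ge0.
Qed.

(* With [q = bilin^2 / phi] and [N = sqsum sqsum / (|S| |T|)], the indicator of
   the event is at most [1 - a q + (a q)^2 / 4 + a N / 20], where [a = 2 / 25]
   minimizes the mean [1 - a + 25 a^2 / 4 + a / 20] up to the last term. *)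
Lemma small_bilin_le M S T (g : R) :
  20 * g ^+ 2 * (#|S|%:R * #|T|%:R) < block_sqnorm M S T ->
  ((gauss_on S \x gauss_on T) (small_bilin M g) <= (241 / 250)%:E)%E.
Proof.
set phi := block_sqnorm M S T; set tt : R := #|S|%:R * #|T|%:R => big_phi.
have phi0 : 0 < phi.
  apply: le_lt_trans big_phi; apply: mulr_ge0; last exact: mulr_ge0.
  by apply: mulr_ge0 => //; exact: sqr_ge0.
have tt0 : 0 < tt.
  rewrite lt0r !mulr_ge0// andbT mulf_eq0 !pnatr_eq0 !cards_eq0.
  apply: contraTN phi0 => /orP[]/eqP X0; rewrite -leNgt.
    by rewrite /phi /block_sqnorm X0 big_set0.
  by rewrite /phi /block_sqnorm X0; under eq_bigr do rewrite big_set0; rewrite big1.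
pose c1 := 2 / 25 / phi; pose c2 := (25 * 25 * phi ^+ 2)^-1.
pose c3 := 2 / 25 / 20 / tt.
have c10 : 0 <= c1 by rewrite /c1 !divr_ge0// ltW.
have c20 : 0 <= c2.
  by rewrite /c2 invr_ge0; apply: mulr_ge0; [exact: mulr_ge0|exact: sqr_ge0].
have c30 : 0 <= c3 by rewrite /c3 !divr_ge0// ltW.
have mE := measurable_small_bilin M g.
set E := small_bilin M g in mE *.
pose z (p : n.-tuple MR * n.-tuple MR) := bilin M p.1 p.2.
pose N (p : n.-tuple MR * n.-tuple MR) := sqsum p.1 * sqsum p.2.
have N0 p : 0 <= N p by rewrite mulr_ge0 ?sqsum_ge0.
have mz k : measurable_fun [set: n.-tuple MR * n.-tuple MR] (fun p => (z p ^+ k)%:E).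
  by apply/measurable_EFinP; apply: measurable_funX; exact: measurable_bilin.
have mN : measurable_fun [set: n.-tuple MR * n.-tuple MR] (fun p => (N p)%:E).
  have ms := @measurable_sqsum R n; apply/measurable_EFinP.
  by apply: measurable_funM; [exact: (measurableT_comp ms)|exact: (measurableT_comp ms)].
have z2 p : (0 <= (z p ^+ 2)%:E)%E by rewrite lee_fin sqr_ge0.
have z4 p : (0 <= (z p ^+ 4)%:E)%E by rewrite lee_fin exprn_even_ge0.
have eN p : (0 <= (N p)%:E)%E by rewrite lee_fin.
have pointwise p : \1_E p + c1 * z p ^+ 2 <= 1 + c2 * z p ^+ 4 + c3 * N p.
  have cc : c2 * z p ^+ 4 = (c1 * z p ^+ 2) ^+ 2 / 4.
    by rewrite /c1 /c2; field; rewrite gt_eqF.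
  rewrite cc indicE; case: (boolP (p \in E)) => [|_]; last first.
    (* Off the event, 1 - u + u^2 / 4 is the square (u / 2 - 1)^2. *)
    set u := c1 * _; have := sqr_ge0 (u / 2 - 1).
    have := mulr_ge0 c30 (N0 p); rewrite /=; lra.
  rewrite inE /E /small_bilin /= -/(z p) -/(N p) => zN.
  have : c1 * z p ^+ 2 <= c3 * N p.
    apply: le_trans (ler_wpM2l c10 zN) _; rewrite mulrA; apply: ler_wpM2r => //.
    have -> : c1 * g ^+ 2 = c3 * (20 * g ^+ 2 * tt / phi).
      by rewrite /c1 /c3; field; rewrite !gt_eqF.
    by rewrite ler_piMr// ler_pdivrMr// mul1r ltW.
  by have := sqr_ge0 (c1 * z p ^+ 2); lra.
set mu := (gauss_on S \x gauss_on T)%E.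
have mu1 (c : R) : (\int[mu]_p cst c%:E p = c%:E)%E.
  rewrite integral_cst// -[RHS]mule1; congr (_ * _)%E.
  exact: (probability_setT (gauss_on S \x gauss_on T)%E).
have : (\int[mu]_p ((\1_E p)%:E + c1%:E * (z p ^+ 2)%:E) <=
    \int[mu]_p (1 + c2%:E * (z p ^+ 4)%:E + c3%:E * (N p)%:E))%E.
  apply: ge0_le_integral => //.
  - by move=> p _; rewrite adde_ge0// mule_ge0.
  - by apply: emeasurable_funD; [exact/measurable_EFinP|exact: emeasurable_funM].
  - apply: emeasurable_funD; last exact: emeasurable_funM.
    by apply: emeasurable_funD => //; exact: emeasurable_funM.
  - by move=> p _; rewrite -!EFinM -!EFinD lee_fin; exact: pointwise.
rewrite ge0_integralD//; last 3 first.
- exact/measurable_EFinP.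
- by move=> p _; rewrite mule_ge0.
- exact: emeasurable_funM.
rewrite ge0_integralD//; last 4 first.
- by move=> p _; rewrite adde_ge0// mule_ge0.
- by apply: emeasurable_funD => //; exact: emeasurable_funM.
- by move=> p _; rewrite mule_ge0.
- exact: emeasurable_funM.
rewrite ge0_integralD//; last 2 first.
- by move=> p _; rewrite mule_ge0.
- exact: emeasurable_funM.
rewrite !ge0_integralZl// mu1 integral_indic// setIT.
rewrite integral_bilin_sqr integral_sqsumM -/phi -/tt.
have h4 := integral_bilin_pow4 M S T; rewrite -/phi in h4.
move=> /le_trans/(_ (leeD (leeD (lexx _) (lee_wpmul2l _ h4)) (lexx _))) => /(_ c20).
rewrite -!EFinM -!EFinD.
(* The inequality becomes mu E + 2/25 <= 1 + 1/25 + 1/250. *)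
have -> : c1 * phi = 2 / 25 by rewrite /c1; field; rewrite gt_eqF.
have -> : c2 * (25 * phi ^+ 2) = 25^-1 by rewrite /c2; field; rewrite gt_eqF.
have -> : c3 * tt = 1 / 250 by rewrite /c3; field; rewrite gt_eqF.
have mfin : mu E \is a fin_num.
  rewrite ge0_fin_numE ?measure_ge0//; apply: (le_lt_trans _ (ltry 1)).
  exact: (@probability_le1 _ _ _ (gauss_on S \x gauss_on T)%E).
rewrite -[X in (X + _ <= _)%E]/(mu E).
by move: mfin; case: (mu E) => // e _; rewrite -EFinD !lee_fin; lra.
Qed.

End tail.

(** * Averaging over the random supports *)

Section averages.
Context {R : realType}.
Local Notation MR := (measurableTypeR R).
Variable n : nat.
Implicit Types (S T : {set 'I_n}) (M : 'I_n -> 'I_n -> R).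

Let invC_ge0 t : (0 <= ('C(n, t)%:R^-1 : R)%:E)%E.
Proof. by rewrite lee_fin invr_ge0. Qed.

(** By uniqueness of the product measure the integration can be done over the second factor, so that
    [Unif] appears in the integrand as a finite average and linearity applies. *)
Lemma integral_Unif_swap t (m : {sigma_finite_measure set (n.-tuple MR) -> \bar R})
    (E : set (n.-tuple MR * n.-tuple MR)) : measurable E ->
  ((Unif n t 1 \x m) E = 'C(n, t)%:R^-1%:E *
     \sum_(S : {set 'I_n} | #|S| == t) (gauss_on S \x m) E)%E.
Proof.
move=> mE.
have swap (m1 m2 : {sigma_finite_measure set (n.-tuple MR) -> \bar R}) :
    ((m1 \x m2) E = (m1 \x^ m2) E)%E.
  apply: product_measure_unique => // A B mA mB; exact: product_measure2E.
rewrite (swap (Unif n t 1)) /product_measure2.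
transitivity (\int[m]_y ('C(n, t)%:R^-1%:E *
    \sum_(S <- [seq S : {set 'I_n} <- index_enum _ | #|S| == t])
      gauss_on S (ysection E y)))%E.
  by apply: eq_integral => y _; rewrite big_filter.
have mS S' : measurable_fun [set: n.-tuple MR] (fun y => gauss_on S' (ysection E y)).
  exact: measurable_fun_ysection.
rewrite ge0_integralZl//; last 2 first.
- exact: emeasurable_sum.
- by move=> y _; exact: sume_ge0.
rewrite ge0_integral_sum// big_filter; congr (_ * _)%E.
by apply: eq_bigr => S' _; rewrite (swap (gauss_on S')).
Qed.

Lemma Unif_prodE t t' (E : set (n.-tuple MR * n.-tuple MR)) : measurable E ->
  ((Unif n t 1 \x Unif n t' 1) E = 'C(n, t)%:R^-1%:E * ('C(n, t')%:R^-1%:E *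
     \sum_(S : {set 'I_n} | #|S| == t) \sum_(T : {set 'I_n} | #|T| == t')
       (gauss_on S \x gauss_on T) E))%E.
Proof.
move=> mE; rewrite (integral_Unif_swap _ (Unif n t' 1))//; congr (_ * _)%E.
rewrite ge0_sume_distrr//; last by move=> S _; exact: sume_ge0.
apply: eq_bigr => S _; rewrite /product_measure1.
transitivity (\int[gauss_on S]_x ('C(n, t')%:R^-1%:E *
    \sum_(T <- [seq T : {set 'I_n} <- index_enum _ | #|T| == t'])
      gauss_on T (xsection E x)))%E.
  by apply: eq_integral => x _; rewrite big_filter.
have mS S' : measurable_fun [set: n.-tuple MR] (fun x => gauss_on S' (xsection E x)).
  exact: measurable_fun_xsection.
rewrite ge0_integralZl//; last 2 first.
- exact: emeasurable_sum.
- by move=> y _; exact: sume_ge0.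
by rewrite ge0_integral_sum// big_filter.
Qed.

(** Pairs of supports violating the block bound contribute at most 241/250, the others at most 1. An
    average of 0.99 forces the fraction of good pairs to be at least (0.99 - 0.964) / 0.036 >
    0.72. *)
Lemma typical_blocks M (gamma g : R) t t' : (t <= n)%N -> (t' <= n)%N ->
  0 <= gamma <= g ->
  ((99 / 100)%:E <= (Unif n t 1 \x Unif n t' 1) (small_bilin M gamma))%E ->
  72 / 100 * ('C(n, t)%:R * 'C(n, t')%:R) <=
    \sum_(S : {set 'I_n} | #|S| == t) \sum_(T : {set 'I_n} | #|T| == t')
      (block_sqnorm M S T <= 20 * g ^+ 2 * (t%:R * t'%:R))%R%:R :> R.
Proof.
move=> tn t'n /andP[gamma0 gg]; rewrite Unif_prodE; last exact: measurable_small_bilin.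
have C0 : (0 : R) < 'C(n, t)%:R by rewrite ltr0n bin_gt0.
have C0' : (0 : R) < 'C(n, t')%:R by rewrite ltr0n bin_gt0.
pose b S T : R := (block_sqnorm M S T <= 20 * g ^+ 2 * (t%:R * t'%:R))%R%:R.
have le_b S T : #|S| = t -> #|T| = t' ->
    ((gauss_on S \x gauss_on T) (small_bilin M gamma) <=
      (241 / 250 + 9 / 250 * b S T)%:E)%E.
  move=> St Tt; rewrite /b.
  case: (leP (block_sqnorm M S T) (20 * g ^+ 2 * (t%:R * t'%:R))) => h.
    rewrite (_ : 241 / 250 + _ = 1 :> R); last by rewrite /=; lra.
    apply: (@probability_le1 _ _ _ (gauss_on S \x gauss_on T)%E).
    exact: measurable_small_bilin.
  rewrite /= mulr0 addr0; apply: small_bilin_le; rewrite St Tt.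
  apply: le_lt_trans h; apply: ler_wpM2r; first by rewrite mulr_ge0.
  by apply: ler_wpM2l => //; rewrite ler_pXn2r// ?nnegrE//; exact: le_trans gg.
set A := (\sum_(S | _) _)%E.
have hA : (A <= (\sum_(S : {set 'I_n} | #|S| == t) \sum_(T : {set 'I_n} | #|T| == t')
    (241 / 250 + 9 / 250 * b S T))%:E)%E.
  rewrite -sumEFin; apply: lee_sum => S /eqP St.
  by rewrite -sumEFin; apply: lee_sum => T /eqP Tt; exact: le_b.
move=> /le_trans/(_ (lee_wpmul2l (invC_ge0 t) (lee_wpmul2l (invC_ge0 t') hA))).
rewrite -!EFinM lee_fin ler_pdivlMl// ler_pdivlMl//.
set X := (X in _ <= X); set Y := (Y in _ -> _ <= Y).
suff -> : X = 241 / 250 * ('C(n, t)%:R * 'C(n, t')%:R) + 9 / 250 * Y.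
  by have := mulr_gt0 C0 C0'; lra.
have -> : 'C(n, t)%:R * 'C(n, t')%:R =
    \sum_(S : {set 'I_n} | #|S| == t) \sum_(T : {set 'I_n} | #|T| == t') 1 :> R.
  under eq_bigr do rewrite sum_draws1 -[_%:R]mul1r.
  by rewrite -mulr_suml sum_draws1.
rewrite !mulr_sumr -big_split/=; apply: eq_bigr => S _.
rewrite !mulr_sumr -big_split/=; apply: eq_bigr => T _.
by rewrite mulr1.
Qed.

Lemma sum_card1 (V : nmodType) (F : {set 'I_n} -> V) :
  \sum_(S : {set 'I_n} | #|S| == 1%N) F S = \sum_i F [set i]%SET.
Proof.
transitivity (\sum_(i in [set: 'I_n]%SET) F [set i]%SET); last first.
  by apply: eq_bigl => i; rewrite inE.
have inj : {in [set: 'I_n]%SET &, injective (fun i : 'I_n => [set i]%SET)}.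
  by move=> i j _ _ E; apply/finset.set1P; rewrite -E finset.set11.
rewrite -[RHS](big_imset F inj).
apply: eq_bigl => S; apply/cards1P/imsetP => [[i ->]|[i _ ->]]; first by exists i.
by exists i.
Qed.

Lemma measurable_bilin_diag M :
  measurable_fun [set: n.-tuple MR] (fun y => bilin M y y).
Proof.
apply: measurable_sum => i; apply: measurable_sum => j.
by apply: measurable_funM => //; apply: measurable_funM; exact: measurable_tnth.
Qed.

Definition small_quad M (g : R) : set (n.-tuple MR) :=
  [set y | `|bilin M y y| <= g * sqsum y].

Lemma measurable_small_quad M g : measurable (small_quad M g).
Proof.
have mf : measurable_fun [set: n.-tuple MR] (fun y => g * sqsum y - `|bilin M y y| : R).
  apply: measurable_funB; first by apply: measurable_funM => //; exact: measurable_sqsum.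
  by apply: measurableT_comp => //; exact: measurable_bilin_diag.
rewrite (_ : small_quad M g =
    (fun y => g * sqsum y - `|bilin M y y| : R) @^-1` `[0, +oo[).
  by rewrite -[X in measurable X]setTI; exact: mf.
by apply/seteqP; split => p /=; rewrite in_itv/= andbT subr_ge0.
Qed.

(** With support {i}, almost surely y is a nonzero multiple of the i-th basis vector, and then the
    event says exactly |M_ii| <= g. Hence it is null when this fails. *)
Lemma small_quad_le M i (g : R) :
  (gauss_on [set i]%SET (small_quad M g) <= (`|M i i| <= g)%R%:R%:E :> \bar R)%E.
Proof.
have mD := measurable_small_quad M g.
case: (leP `|M i i| g) => h; first exact: probability_le1.
pose B (j : 'I_n) : set MR := if j == i then ~` [set 0] else [set 0].
have mB j : measurable (B j).
  by rewrite /B; case: ifP => _; [apply: measurableC|]; exact: measurable_set1.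
pose N : set (n.-tuple MR) := [set y | forall j, B j (tnth y j)].
have mN : measurable N by exact: measurable_box.
have N1 : gauss_on [set i]%SET N = 1%E.
  rewrite /gauss_on /N product_law_box// big1// => j _.
  rewrite /coord_law inE /B; case: eqP => _.
    rewrite sqrtr1 probability_setC; last exact: (measurable_set1 (0 : R)).
    by rewrite /= /normal_prob integral_set1 sube0.
  have d1 : (\d_(0%R : MR) [set (0%R : MR)] = 1 :> \bar R)%E by rewrite diracE mem_set.
  exact: d1.
have DN : small_quad M g `<=` ~` N.
  move=> y /= Dy Ny.
  have yi : tnth y i != 0 by have := Ny i; rewrite /B eqxx /= => /eqP.
  have yj j : j != i -> tnth y j = 0 by move=> ji; have := Ny j; rewrite /B (negbTE ji).
  have bE : bilin M y y = tnth y i * tnth y i * M i i.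
    have out k l : (k != i) || (l != i) -> tnth y k * tnth y l * M k l = 0.
      by case/orP => /yj ->; rewrite ?mul0r ?mulr0 ?mul0r.
    rewrite /bilin (bigD1 i)//= [\sum_(k | k != i) _]big1 ?addr0; last first.
      by move=> k ki; apply: big1 => l _; rewrite out ?ki.
    by rewrite (bigD1 i)//= big1 ?addr0// => l li; rewrite out ?li ?orbT.
  have sE : sqsum y = tnth y i ^+ 2.
    by rewrite /sqsum (bigD1 i)//= big1 ?addr0// => l li; rewrite yj// expr0n.
  move: Dy; rewrite /small_quad /= bE sE.
  rewrite -expr2 normrM (ger0_norm (sqr_ge0 _)) mulrC ler_pM2r; last first.
    by rewrite exprn_even_gt0.
  by rewrite leNgt h.
apply: (@le_trans _ _ (gauss_on [set i]%SET (~` N))).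
  by apply: le_measure => //; rewrite inE//; exact: measurableC.
by rewrite probability_setC// N1 subee.
Qed.

Lemma typical_diagonal M (gamma g : R) : (0 < n)%N -> gamma <= g ->
  ((99 / 100)%:E <= Unif n 1 1 (small_quad M gamma))%E ->
  99 / 100 * n%:R <= \sum_i (`|M i i| <= g)%R%:R :> R.
Proof.
move=> n0 gg; rewrite /Unif bin1 sum_card1 => h.
have hs : (\sum_i gauss_on [set i]%SET (small_quad M gamma) <=
    \sum_i ((`|M i i| <= gamma)%R%:R : R)%:E)%E.
  by apply: lee_sum => i _; exact: small_quad_le.
have n0' : (0 <= ((n%:R : R)^-1)%:E)%E by rewrite lee_fin invr_ge0.
move: (le_trans h (lee_wpmul2l n0' hs)); rewrite sumEFin -EFinM lee_fin.
rewrite ler_pdivlMl ?ltr0n// mulrC => /le_trans; apply.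
apply: ler_sum => i _; rewrite ler_nat.
by case: (leP `|M i i| gamma) => // hi; rewrite (le_trans hi).
Qed.

End averages.

(** * From the linear map to its Gram matrix *)

Section linear_map.
Context {R : realType} (n m : nat) (A : {linear 'cV[R]_n -> 'cV[R]_m}).
Local Notation MR := (measurableTypeR R).
Implicit Types x y : n.-tuple MR.

Definition lin_matrix : 'M[R]_(m, n) := \matrix_(a, i) A (delta_mx i 0) a 0.

Definition gram_defect (i j : 'I_n) : R :=
  (lin_matrix^T *m lin_matrix) i j - (i == j)%:R.

Lemma lin_vecE x a : A (vec x) a 0 = \sum_i tnth x i * lin_matrix a i.
Proof.
have -> : vec x = \sum_i tnth x i *: delta_mx i 0.
  apply/matrixP => i j; rewrite summxE !mxE (bigD1 i)//= !mxE (ord1 j) !eqxx mulr1.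
  by rewrite big1 ?addr0// => k ki; rewrite !mxE eq_sym (negbTE ki) mulr0.
rewrite linear_sum summxE; apply: eq_bigr => i _.
by rewrite linearZ !mxE.
Qed.

Lemma dotv_defectE x y :
  dotv (A (vec x)) (A (vec y)) - dotv (vec x) (vec y) = bilin gram_defect x y.
Proof.
rewrite /dotv /bilin.
have -> : \sum_i vec x i 0 * vec y i 0 =
    \sum_i \sum_j tnth x i * tnth y j * (i == j)%:R.
  apply: eq_bigr => i _; rewrite (bigD1 i)//= eqxx mulr1 !mxE big1 ?addr0// => j ji.
  by rewrite eq_sym (negbTE ji) mulr0.
have -> : \sum_a A (vec x) a 0 * A (vec y) a 0 =
    \sum_i \sum_j tnth x i * tnth y j * (lin_matrix^T *m lin_matrix) i j.
  under eq_bigr do rewrite !lin_vecE mulr_suml.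
  rewrite exchange_big/=; apply: eq_bigr => i _.
  under eq_bigr do rewrite mulr_sumr.
  rewrite exchange_big/=; apply: eq_bigr => j _.
  rewrite mxE mulr_sumr; apply: eq_bigr => a _.
  by rewrite [lin_matrix^T _ _]mxE; ring.
rewrite -sumrB; apply: eq_bigr => i _; rewrite -sumrB; apply: eq_bigr => j _.
by rewrite /gram_defect mulrBr.
Qed.

Lemma norm2_sqr k (u : 'cV[R]_k) : norm2 u ^+ 2 = dotv u u.
Proof.
by rewrite /norm2 sqr_sqrtr//; apply: sumr_ge0 => i _; rewrite -expr2 sqr_ge0.
Qed.

Lemma norm2_vec_sqr x : norm2 (vec x) ^+ 2 = sqsum x.
Proof.
by rewrite norm2_sqr; apply: eq_bigr => i _; rewrite mxE expr2.
Qed.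

Lemma small_bilinE (g : R) : 0 <= g ->
  [set p : n.-tuple MR * n.-tuple MR | let x := vec p.1 in let y := vec p.2 in
    `|dotv (A x) (A y) - dotv x y| <= g * norm2 x * norm2 y] =
  small_bilin gram_defect g.
Proof.
move=> g0; apply/seteqP; split => p /=; rewrite /small_bilin /= dotv_defectE.
  rewrite -(ler_pXn2r (n := 2))// ?nnegrE ?normr_ge0 ?mulr_ge0 ?sqrtr_ge0//.
  by rewrite real_normK ?num_real// !exprMn !norm2_vec_sqr mulrA.
rewrite -[_ <= _ * norm2 _](ler_pXn2r (n := 2))// ?nnegrE ?normr_ge0 ?mulr_ge0 ?sqrtr_ge0//.
by rewrite real_normK ?num_real// !exprMn !norm2_vec_sqr mulrA.
Qed.

Lemma small_quadE (g : R) :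
  [set p : n.-tuple MR | let y := vec p in
    `|norm2 (A y) ^+ 2 - norm2 y ^+ 2| <= g * norm2 y ^+ 2] =
  small_quad gram_defect g.
Proof.
apply/seteqP; split => p /=.
  by rewrite norm2_sqr [in X in X -> _]norm2_sqr dotv_defectE -norm2_sqr norm2_vec_sqr.
by rewrite norm2_sqr [in X in _ -> X]norm2_sqr dotv_defectE -norm2_sqr norm2_vec_sqr.
Qed.

End linear_map.

Theorem mainTheorem5 (R : realType) :
  exists2 C : R, 0 < C &
  forall (s : nat) (gamma : R) (m : nat)
    (A : {linear 'cV[R]_(s ^ 2) -> 'cV[R]_m}),
    (1 <= s)%N ->
    0 <= gamma <= C / s%:R ->
    (exists v, A v != 0) ->
    (forall t t' : nat, (1 <= t <= s)%N -> (1 <= t' <= s)%N ->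
      ((99 / 100)%:E <=
       (Unif (s ^ 2) t 1 \x Unif (s ^ 2) t' 1)
         [set p : (s ^ 2).-tuple R * (s ^ 2).-tuple R |
           let x := vec p.1 in let y := vec p.2 in
           (`|dotv (A x) (A y) - dotv x y| <= gamma * norm2 x * norm2 y)%R])%E) ->
    ((99 / 100)%:E <=
     Unif (s ^ 2) 1 1
       [set p : (s ^ 2).-tuple R |
         let y := vec p in
         (`|norm2 (A y) ^+ 2 - norm2 y ^+ 2| <= gamma * norm2 y ^+ 2)%R])%E ->
    (s ^ 2)%:R / 1000 <= m%:R :> R.
Proof.
(* With this constant 20 (g s)^2 = 2 / 10^5, the largest c2 that [rank_bound] admits. *)
exists 1000^-1; first by rewrite invr_gt0 ltr0n.
move=> s gamma m A s1 /andP[gamma0 gammaC] _ hpair hdiag.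
have sR : 0 < s%:R :> R by rewrite ltr0n.
have sge1 : 1 <= s%:R :> R by rewrite ler1n.
set g : R := 1000^-1 / s%:R in gammaC.
have g0 : 0 <= g by exact: le_trans gammaC.
have gE : g * s%:R = 1000^-1 by rewrite /g divfK ?gt_eqF.
have g1 : g <= 1000^-1.
  have : 0 <= 1000^-1 :> R by rewrite invr_ge0 ler0n.
  by rewrite /g; move: (1000^-1 : R) => k k0; rewrite ler_pdivrMr// ler_peMr.
have sn : (s <= s ^ 2)%N by rewrite expnS expn1 leq_pmulr.
have n0 : (0 < s ^ 2)%N by rewrite expn_gt0 s1.
have gammag : 0 <= gamma <= g by rewrite gamma0.
pose M := gram_defect A.
have typical t t' : (1 <= t <= s)%N -> (1 <= t' <= s)%N ->
    72 / 100 * ('C(s ^ 2, t)%:R * 'C(s ^ 2, t')%:R) <=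
    \sum_(S : {set 'I_(s ^ 2)} | #|S| == t) \sum_(T : {set 'I_(s ^ 2)} | #|T| == t')
      (block_sqnorm M S T <= 20 * g ^+ 2 * (t%:R * t'%:R))%R%:R :> R.
  move=> tb tb'; have := hpair t t' tb tb'.
  rewrite (small_bilinE A gamma0); apply: typical_blocks => //.
    by case/andP: tb => _ /leq_trans; apply.
  by case/andP: tb' => _ /leq_trans; apply.
have diag : 99 / 100 * (s ^ 2)%:R <= \sum_i (`|M i i| <= g)%R%:R :> R.
  by move: hdiag; rewrite small_quadE; apply: typical_diagonal => //; case/andP: gammag.
pose c2 : R := 20 * (g * s%:R) ^+ 2.
have c2E : c2 = 2 / (1000 * 100) by rewrite /c2 gE; field.
have c20 : 0 < c2 by rewrite c2E; lra.
have Msym i j : M i j = M j i.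
  rewrite /M /gram_defect eq_sym; congr (_ - _).
  by rewrite -[in LHS](trmxK (lin_matrix A)) -trmx_mul trmxK mxE.
have ss : (1 <= s <= s)%N by rewrite s1 leqnn.
(* The case t = 1, t' = s, where supports of size 1 are single rows and 20 g^2 s = c2 / s. *)
have row : 72 / 100 * ((s ^ 2)%:R * 'C(s ^ 2, s)%:R) <=
    \sum_i \sum_(T : {set 'I_(s ^ 2)} | #|T| == s)
      (\sum_(j in T) M i j ^+ 2 <= c2 / s%:R)%R%:R :> R.
  have := typical 1%N s s1 ss; rewrite bin1 sum_card1 => /le_trans; apply.
  apply: ler_sum => i _; apply: ler_sum => T _.
  rewrite /block_sqnorm big_set1 mul1r.
  suff -> : 20 * g ^+ 2 * s%:R = c2 / s%:R by [].
  by rewrite /c2; field; rewrite gt_eqF.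
have block : 72 / 100 * 'C(s ^ 2, s)%:R ^+ 2 <=
    \sum_(S : {set 'I_(s ^ 2)} | #|S| == s) \sum_(T : {set 'I_(s ^ 2)} | #|T| == s)
      (\sum_(i in S) \sum_(j in T) M i j ^+ 2 <= c2)%R%:R :> R.
  have := typical s s ss ss; rewrite -expr2 => /le_trans; apply.
  suff -> : 20 * g ^+ 2 * (s%:R * s%:R) = c2 by [].
  by rewrite /c2; ring.
have [I [cI Idiag Ioff]] := good_submatrix s1 c20 Msym diag row block.
apply: (rank_bound s1 _ _ cI Idiag Ioff).
  by rewrite g0.
by rewrite (ltW c20)/= c2E lexx.
Qed.
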